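(* Let $\alpha\in\mathbb{R}\setminus\pi\mathbb{Z}$ and suppose $s>0$ (real). If $f\in e_{-\alpha}L^1(\mathbf{T}^n_\alpha)$ satisfies, for some constant $C$, $$|\mathcal{F}_\alpha(f)(m)|\le C(1+|m|)^{-s-n}$$ for all $m\in\mathbb{Z}^n$, then $e_\alpha f$ has partial derivatives of all orders $|\beta|\le[[s]]$. Moreover, $\partial^\beta(e_\alpha f)\in\dot\Lambda_\gamma(\mathbf{T}^n_\alpha)$ for all multi-indices $\beta$ satisfying $|\beta|=[[s]]$ and all $0<\gamma<s-[[s]]$.
   Context: $[[s]]$ denotes the largest integer strictly less than the real number $s$. Let $n\ge 1$ and $\alpha\in\mathbb{R}\setminus\pi\mathbb{Z}$. The fractional torus $\mathbf{T}^n_\alpha$ is the cube of side $|\sin\alpha|$ with opposite sides identified, represented by $[-|\sin\alpha|/2,|\sin\alpha|/2]^n$; functions on $\mathbf{T}^n_\alpha$ are functions on $\mathbb{R}^n$ that are $|\sin\alpha|$-periodic in each coordinate, equivalently functions on this cube, and integrals over $\mathbf{T}^n_\alpha$ are taken over this cube with Lebesgue measure. Put $e_\alpha(x)=e^{\pi i|x|^2\cot\alpha}$, $e_{-\alpha}(x)=e^{-\pi i|x|^2\cot\alpha}$. $e_{-\alpha}L^1(\mathbf{T}^n_\alpha)$ is the space of functions $f=e_{-\alpha}g$ on the cube with $g\in L^1(\mathbf{T}^n_\alpha)$; for such $f$, $e_\alpha f$ denotes the periodic function $g$. Integrable functions are identified when equal almost everywhere, so regularity assertions refer to a suitable representative.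 Put $A_\alpha=\sqrt{1-i\cot\alpha}$ (principal branch), $e_\alpha(m,x)=e^{-2\pi i(m\cdot x)\csc\alpha}$, $K_\alpha(m,x)=A_\alpha^n e_\alpha(x)e_\alpha(m,x)e_\alpha(m)$, and $\mathcal{F}_\alpha(f)(m)=\int_{\mathbf{T}^n_\alpha}f(x)K_\alpha(m,x)\,dx$, $m\in\mathbb{Z}^n$. For $0<\gamma<1$, $\dot\Lambda_\gamma(\mathbf{T}^n_\alpha)$ is the set of $f:\mathbf{T}^n_\alpha\to\mathbb{C}$ with $\|f\|_{\dot\Lambda_\gamma}:=\sup_{x,h\in\mathbf{T}^n_\alpha,\,h\ne0}\frac{|f(x+h)-f(x)|}{|h|^\gamma}<\infty$, where $h$ ranges over the nonzero points of the cube $[-|\sin\alpha|/2,|\sin\alpha|/2]^n$. *)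

(* Defs.v *)
From HB Require Import structures.
From mathcomp Require Import all_boot all_order all_algebra.
From mathcomp Require Import all_classical all_reals all_analysis.
From mathcomp Require Import complex.

Set Implicit Arguments.
Unset Strict Implicit.
Unset Printing Implicit Defensive.

Import Order.TTheory GRing.Theory Num.Theory.
Import numFieldNormedType.Exports.

Local Open Scope classical_set_scope.
Local Open Scope ring_scope.
Local Open Scope complex_scope.

(* Real row vectors carry the product (equivalently, Borel) sigma-algebra,
   generated by the coordinate maps, as the library does for tuples. *)
Fact measure_rV_display : measure_display.
Proof. exact: measure_tuple_display default_measure_display. Qed.

Section measurable_rV.
Variables (R : realType) (n : nat).

Definition rV_coor (i : 'I_n) (x : 'rV[R]_n) : measurableTypeR R := x ord0 i.

Let rV_set0 : g_sigma_preimage rV_coor set0.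
Proof. exact: sigma_algebra0. Qed.

Let rV_setC A : g_sigma_preimage rV_coor A -> g_sigma_preimage rV_coor (~` A).
Proof. exact: sigma_algebraC. Qed.

Let rV_bigcup (F : (set 'rV[R]_n)^nat) :
  (forall i, g_sigma_preimage rV_coor (F i)) ->
  g_sigma_preimage rV_coor (\bigcup_i (F i)).
Proof. exact: sigma_algebra_bigcup. Qed.

HB.instance Definition _ := @isMeasurable.Build measure_rV_display
  'rV[R]_n (g_sigma_preimage rV_coor) rV_set0 rV_setC rV_bigcup.

End measurable_rV.

Section lebesgue_rV.
Variable R : realType.

Definition rV_cons n (p : 'rV[R]_n * measurableTypeR R) : 'rV[R]_n.+1 :=
  \row_i oapp (fun j => p.1 ord0 j) p.2 (unlift ord0 i).

Lemma measurable_rV_coor n (i : 'I_n) :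
  measurable_fun [set: 'rV[R]_n] (@rV_coor R n i).
Proof.
move=> _ Y mY; rewrite setTI; apply: sub_sigma_algebra => /=.
rewrite -bigcup_seq/=; exists i => /=; first by rewrite mem_index_enum.
by exists Y => //; rewrite setTI.
Qed.

Lemma measurable_rV_cons n : measurable_fun setT (@rV_cons n).
Proof.
apply: (@measurability _ _ _ _ _ _ (\big[setU/set0]_(i < n.+1)
  preimage_set_system setT (@rV_coor R n.+1 i) measurable)) => //.
move=> _ [B + <-].
rewrite -bigcup_seq => -[i _ [A mA <-]]; rewrite !setTI -comp_preimage.
rewrite -[X in measurable X]setTI.
have [j ->|->] := unliftP ord0 i.
- have -> : @rV_coor R n.+1 (lift ord0 j) \o @rV_cons n = rV_coor j \o fst.
    by apply/funext => p /=; rewrite /rV_coor /rV_cons mxE liftK.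
  by apply: measurableT_comp => //; exact: measurable_rV_coor.
- have -> : @rV_coor R n.+1 ord0 \o @rV_cons n = snd.
    by apply/funext => p /=; rewrite /rV_coor /rV_cons mxE unlift_none.
  exact: measurable_snd.
Qed.

Definition lebesgue_rVS n (mu : {measure set 'rV[R]_n -> \bar R}) :=
  pushforward (mu \x @lebesgue_measure R)%E (@rV_cons n).

HB.instance Definition _ n mu := Measure.copy (@lebesgue_rVS n mu)
  (measure_function_pushforward__canonical__measure_function_Measure _
    (@measurable_rV_cons n)).

(* n-dimensional Lebesgue measure, as an iterated product measure. *)
Fixpoint lebesgue_rV n : {measure set 'rV[R]_n -> \bar R} :=
  if n is m.+1 then lebesgue_rVS (lebesgue_rV m) else dirac (0 : 'rV[R]_0).

Lemma lebesgue_rV_box n (A : 'I_n -> set (measurableTypeR R)) :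
  (forall i, measurable (A i)) ->
  lebesgue_rV n [set x : 'rV[R]_n | forall i, A i (x ord0 i)] =
  (\prod_(i < n) lebesgue_measure (A i))%E.
Proof.
elim: n A => [|n IHn] A mA.
  by rewrite big_ord0 /= diracE mem_set// => -[].
have mbox m (B : 'I_m -> set (measurableTypeR R)) : (forall i, measurable (B i)) ->
    measurable [set x : 'rV[R]_m | forall i, B i (x ord0 i)].
  move=> mB; rewrite (_ : mkset _ = \big[setI/setT]_(i < m) (rV_coor i @^-1` B i)).
    apply: bigsetI_measurable => i _; rewrite -[X in measurable X]setTI.
    exact: measurable_rV_coor.
  apply/seteqP; split => x /=; rewrite -bigcap_seq => Bx i //.
    by move=> _; exact: Bx.
  by apply: (Bx i); rewrite /= mem_index_enum.
have mA' j : measurable (A (lift ord0 j)) by [].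
rewrite big_ord_recl muleC -(IHn _ mA').
rewrite -(product_measure1E _ _ (mbox _ _ mA') (mA ord0)) /=.
rewrite /lebesgue_rVS /pushforward; congr (product_measure1 _ _ _).
apply/seteqP; split => -[x a] /=.
  move=> Ax; split=> [i|].
    by have := Ax (lift ord0 i); rewrite mxE liftK.
  by have := Ax ord0; rewrite mxE unlift_none.
move=> [Ax Aa] i; rewrite mxE.
by have [j ->|->] := unliftP ord0 i.
Qed.

End lebesgue_rV.

Section fractional_torus.
Variable R : realType.
Implicit Types (alpha gamma s t : R) (n : nat).

Definition cot alpha : R := cos alpha / sin alpha.

Definition csc alpha : R := (sin alpha)^-1.

(* e^(i t) *)
Definition expi t : R[i] := (cos t +i* sin t)%C.

Definition enorm n (x : 'rV[R]_n) : R := Num.sqrt (\sum_i x ord0 i ^+ 2).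

Definition dotr n (x y : 'rV[R]_n) : R := \sum_i x ord0 i * y ord0 i.

Definition torus_cube alpha n : set 'rV[R]_n :=
  [set x | forall i, `|x ord0 i| <= `|sin alpha| / 2].

Definition torus_periodic alpha n (g : 'rV[R]_n -> R[i]) : Prop :=
  forall x i, g (x + `|sin alpha| *: delta_mx ord0 i) = g x.

Definition chirp alpha n (x : 'rV[R]_n) : R[i] :=
  expi (pi * enorm x ^+ 2 * cot alpha).

Lemma chirpN alpha n (x : 'rV[R]_n) :
  chirp (- alpha) x = expi (- (pi * enorm x ^+ 2 * cot alpha)).
Proof. by rewrite /chirp /cot cosN sinN invrN !mulrN. Qed.

Definition torus_L1 alpha n (g : 'rV[R]_n -> R[i]) : Prop :=
  [/\ torus_periodic alpha g,
      (lebesgue_rV R n).-integrable (@torus_cube alpha n)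
        (fun x => (complex.Re (g x))%:E) &
      (lebesgue_rV R n).-integrable (@torus_cube alpha n)
        (fun x => (complex.Im (g x))%:E)].

(* Only the values of f on the cube matter; f itself need not be periodic. *)
Definition chirp_L1 alpha n (f : 'rV[R]_n -> R[i]) : Prop :=
  exists2 g, torus_L1 alpha g &
    forall x, torus_cube alpha x -> f x = chirp (- alpha) x * g x.

Definition torus_int alpha n (f : 'rV[R]_n -> R[i]) : R[i] :=
  (\int[lebesgue_rV R n]_(x in @torus_cube alpha n) complex.Re (f x) +i*
   \int[lebesgue_rV R n]_(x in @torus_cube alpha n) complex.Im (f x))%C.

(* sqrtc is the principal branch (nonnegative real part). *)
Definition frac_cst alpha : R[i] := sqrtc (1 -i* cot alpha)%C.

Definition frac_kernel alpha n (m x : 'rV[R]_n) : R[i] :=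
  frac_cst alpha ^+ n * chirp alpha x *
  expi (- (2 * pi * dotr m x * csc alpha)) * chirp alpha m.

Definition int_rV n (m : 'rV[int]_n) : 'rV[R]_n := map_mx intr m.

Definition frac_fourier alpha n (f : 'rV[R]_n -> R[i]) (m : 'rV[int]_n) : R[i] :=
  torus_int alpha (fun x => f x * frac_kernel alpha (int_rV m) x).

(* [[s]], the largest integer strictly less than s *)
Definition strict_floor s : int := Num.ceil s - 1.

Lemma strict_floorP s : (strict_floor s)%:~R < s /\
  forall k : int, k%:~R < s -> k <= strict_floor s.
Proof.
split=> [|k ks]; first exact: ceilB1_lt.
by rewrite /strict_floor lerBrDr lezD1 ceil_gt_int.
Qed.

(* A complex-valued function of real variables is differentiated through its
   real and imaginary parts. *)
Definition partial_derivable n (i : 'I_n) (g : 'rV[R]_n -> R[i]) : Prop :=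
  forall x : 'rV[R]_n,
    derivable (fun y => complex.Re (g y)) x (delta_mx ord0 i) /\
    derivable (fun y => complex.Im (g y)) x (delta_mx ord0 i).

Definition partial n (i : 'I_n) (g : 'rV[R]_n -> R[i]) : 'rV[R]_n -> R[i] :=
  fun x => ('D_(delta_mx ord0 i) (fun y => complex.Re (g y)) x +i*
            'D_(delta_mx ord0 i) (fun y => complex.Im (g y)) x)%C.

(* Iterated partial derivatives along the word w, leftmost letter first. *)
Fixpoint word_derivable n (w : seq 'I_n) (g : 'rV[R]_n -> R[i]) : Prop :=
  if w is i :: w' then partial_derivable i g /\ word_derivable w' (partial i g)
  else True.

Definition word_partial n (w : seq 'I_n) (g : 'rV[R]_n -> R[i]) :=
  foldl (fun h i => partial i h) g w.

Definition mi_order n (beta : 'I_n -> nat) : nat := (\sum_i beta i)%N.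

Definition mi_word n (beta : 'I_n -> nat) : seq 'I_n :=
  flatten [seq nseq (beta i) i | i <- enum 'I_n].

Definition mi_partial n (beta : 'I_n -> nat) (g : 'rV[R]_n -> R[i]) :=
  word_partial (mi_word beta) g.

(* The derivative of multi-index beta exists everywhere, whatever the order in
   which the differentiations are performed, and does not depend on it. *)
Definition has_mi_partial n (beta : 'I_n -> nat) (g : 'rV[R]_n -> R[i]) : Prop :=
  forall w : seq 'I_n, perm_eq w (mi_word beta) ->
    word_derivable w g /\ word_partial w g = mi_partial beta g.

Definition dotLambda_norm alpha gamma n (f : 'rV[R]_n -> R[i]) : \bar R :=
  ereal_sup [set q : \bar R | exists x h : 'rV[R]_n,
    [/\ torus_cube alpha x, torus_cube alpha h, h != 0 &
        q = (Normc.normc (f (x + h) - f x) / enorm h `^ gamma)%:E]].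

Definition dotLambda alpha gamma n (f : 'rV[R]_n -> R[i]) : Prop :=
  torus_periodic alpha f /\ (dotLambda_norm alpha gamma f < +oo)%E.

End fractional_torus.

(* Main.v *)
Require Import Defs.
From HB Require Import structures.
From mathcomp Require Import all_boot all_order all_algebra.
From mathcomp Require Import all_classical all_reals all_analysis.
From mathcomp Require Import measurable_realfun.
From mathcomp Require Import complex.
From mathcomp Require Import ring lra.

(** The chirp of [f] and that of the kernel cancel on the cube, so, with [g] the
    periodic function [e_alpha f], the modulus of the fractional transform of [f]
    at [m] is a nonzero constant times that of the [m]-th Fourier coefficient of
    [g] for the period [|sin alpha|] (lemma [frac_fourier_chirp]). The hypothesis
    is thus a decay [(1 + |m|) ^ (- s - n)] of those coefficients.

    Such coefficients are absolutely summable over the lattice, even after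
    multiplication by [|m| ^ t] for any [t < s] (lemma [lattice_summable_powR]).
    Hence the Fourier series converges absolutely to a continuous periodic
    function [G], the sum [cfseries]. Differentiating a term multiplies its
    coefficient by [i om m_j], and dominated convergence allows termwise
    differentiation as long as the new coefficients are summable
    (lemma [is_derive_fseries]), that is, up to the largest integer order
    [k < s]. The factors [i om m_j] commute, so the order of differentiation is
    irrelevant (lemma [perm_wcoef]). The derivatives of order [k] have
    coefficients of decay [(1 + |m|) ^ (- (s - k) - n)]; bounding each increment
    [|e^(i t) - e^(i t')|] by [2 |t - t'| ^ gamma] and summing gives the Hoelder
    estimate for every [gamma < s - k] (lemma [fseries_hoelder]).

    It remains to see that [G] equals [g] almost everywhere. Both have the same
    Fourier coefficients, by termwise integration and the orthogonality of the
    characters (lemmas [integral_cube_cos1] and [integral_cfseries_char]), so one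
    needs that an integrable function [u] whose coefficients all vanish is zero
    (lemma [fourier_uniqueness]). Consider the bounded functions whose product
    with [u] still has zero coefficients, and the multipliers of that space. By
    the product formula for cosines, trigonometric monomials are multipliers;
    and multipliers form an algebra closed under bounded pointwise limits. Such
    an algebra contains, with a function [f], the indicators of the sets
    [f <= c], as limits of polynomials in [f] (lemma [bounded_algebra_level]), and
    the sets whose indicators it contains form a sigma-algebra. The level sets of
    [cos (om (x_i - c))] cut the cube, up to null sets, along all intervals of each
    coordinate, so every measurable set is reached and [u] integrates to zero on
    each of them. *)

Import Order.TTheory GRing.Theory Num.Theory.
Import numFieldNormedType.Exports.

Local Open Scope classical_set_scope.
Local Open Scope ring_scope.
Local Open Scope complex_scope.

Set Implicit Arguments.
Unset Strict Implicit.
Unset Printing Implicit Defensive.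

(** * Partial sums of the zeta series *)

(** With [b = j + 2] and [a = j + 1], [a ^ (- e)] is [b ^ (- e)] times the
    exponential of [e * (ln b - ln a)], which is at least [1 + e / b] because
    [ln (a / b) <= a / b - 1]. *)
Lemma powR_succ_telescope (R : realType) (e : R) (j : nat) : 0 < e ->
  e * j.+2%:R `^ (- 1 - e) <= j.+1%:R `^ (- e) - j.+2%:R `^ (- e).
Proof.
move=> e0.
have a0 : 0 < j.+1%:R :> R by rewrite ltr0n.
have b0 : 0 < j.+2%:R :> R by rewrite ltr0n.
have hln : j.+2%:R^-1 <= ln j.+2%:R - ln j.+1%:R :> R.
  have : ln (1 + (- j.+2%:R^-1)) <= - j.+2%:R^-1 :> R.
    apply: le_ln1Dx; rewrite ltrN2 invf_lt1// ltr1n//.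
  have -> : 1 + (- j.+2%:R^-1) = j.+1%:R / j.+2%:R :> R.
    apply: (mulIf (lt0r_neq0 b0)).
    by rewrite mulrDl mul1r mulNr mulVf ?mulfVK ?gt_eqF// -natr1 addrK.
  by rewrite ln_div ?posrE// lerNr opprB.
have -> : j.+1%:R `^ (- e) =
    j.+2%:R `^ (- e) * expR (e * (ln j.+2%:R - ln j.+1%:R)) :> R.
  by rewrite /powR !gt_eqF// -expRD; congr expR; lra.
have -> : j.+2%:R `^ (- 1 - e) = j.+2%:R `^ (- e) * j.+2%:R^-1 :> R.
  rewrite powRD; last by rewrite (gt_eqF b0) implybT.
  by rewrite mulrC powR_inv1 ?ltW.
have p0 := powR_gt0 (- e) b0.
have := expR_ge1Dx (e * (ln j.+2%:R - ln j.+1%:R)).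
set E := expR _; set P := _ `^ _; set d := _ - _ => hE.
have hd : e * j.+2%:R^-1 <= e * d by rewrite ler_pM2l.
rewrite -subr_ge0.
have -> : P * E - P - e * (P * j.+2%:R^-1) = P * (E - 1 - e * j.+2%:R^-1) by ring.
rewrite mulr_ge0 ?powR_ge0//.
by rewrite -addrA -opprD subr_ge0 (le_trans _ hE)// lerD2l.
Qed.

Lemma sum_powR_le (R : realType) (e : R) (N : nat) : 0 < e ->
  \sum_(j < N) j.+1%:R `^ (- 1 - e) <= 1 + e^-1.
Proof.
move=> e0; case: N => [|N]; first by rewrite big_ord0 addr_ge0 ?invr_ge0 ?ltW.
suff : \sum_(j < N.+1) j.+1%:R `^ (- 1 - e) <= 1 + e^-1 * (1 - N.+1%:R `^ (- e)).
  move/le_trans; apply; rewrite lerD2l.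
  by rewrite -[leRHS]mulr1 ler_wpM2l ?invr_ge0 ?gerBl ?powR_ge0 ?ltW//.
elim: N => [|N IHN].
  by rewrite big_ord_recr big_ord0 /= !powR1 subrr mulr0 add0r addr0.
rewrite big_ord_recr /=; apply: le_trans (lerD IHN (lexx _)) _.
have := powR_succ_telescope N e0; set p := _ `^ (-1 - e).
rewrite -ler_pdivlMl// => h.
by apply: le_trans (lerD (lexx _) h) _; rewrite -addrA -mulrDr; lra.
Qed.

Lemma ler_sum_subset (R : realType) (I : eqType) (s s' : seq I) (F : I -> R) :
  (forall i, 0 <= F i) -> uniq s -> {subset s <= s'} ->
  \sum_(i <- s) F i <= \sum_(i <- s') F i.
Proof.
move=> F0; elim: s s' => [|x s IHs] s' /=; first by rewrite big_nil sumr_ge0.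
move=> /andP[xs us] ss'; have xs' : x \in s' by rewrite ss' ?mem_head.
rewrite big_cons (perm_big _ (perm_to_rem xs')) big_cons lerD2l.
apply: IHs => // y ys.
have /perm_mem/(_ y) := perm_to_rem xs'.
rewrite ss' ?in_cons ?ys ?orbT// => /esym/orP[/eqP yx|//].
by rewrite -yx ys in xs.
Qed.

Lemma sum_int_powR_le (R : realType) (e : R) (B : nat)
    (t := [seq Posz i | i <- iota 0 B.+1] ++ [seq Negz i | i <- iota 0 B.+1]) :
  0 < e ->
  \sum_(k <- t) (1 + `|k%:~R|) `^ (- 1 - e) <= 2 * (1 + e^-1).
Proof.
move=> e0; rewrite big_cat !big_map.
have -> : iota 0 B.+1 = index_iota 0 B.+1 by rewrite /index_iota subn0.
rewrite !big_mkord mulrDl mul1r.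
apply: lerD; apply: le_trans (sum_powR_le B.+1 e0); apply: ler_sum => i _.
  by rewrite -pmulrn normr_nat -[in leRHS]natr1 addrC.
rewrite NegzE mulrNz normrN -pmulrn normr_nat.
have b0 : 0 < i.+1%:R :> R by rewrite ltr0n.
rewrite -opprD !powRN lef_pV2 ?posrE ?powR_gt0 ?ltr_wpDl//.
by rewrite ge0_ler_powR ?nnegrE; lra.
Qed.

(** * Sums over the integer lattice *)

Section lattice_sums.
Variables (R : realType) (n : nat).

(** Sums over the lattice are series over [nat], along the partial inverse of
    an injection of the countable lattice into [nat]; indices outside its range
    carry zero. *)
Definition lattice_seq (V : zmodType) (F : 'rV[int]_n -> V) (k : nat) : V :=
  oapp F 0 (pickle_inv k).

Definition lattice_summable (F : 'rV[int]_n -> R) :=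
  cvgn (series (lattice_seq F)).

Lemma series_lattice_seq (F : 'rV[int]_n -> R) N :
  series (lattice_seq F) N =
  \sum_(m <- pmap pickle_inv (iota 0 N)) F m.
Proof.
by rewrite big_pmap /series /= /index_iota subn0.
Qed.

(** Expanding the power of the one-dimensional sum gives the sum over all points
    with coordinates in [t], of which [s] is a part. *)
Lemma sum_prod_coord_le (w : int -> R) (s : seq 'rV[int]_n) (t : seq int) :
  (forall k, 0 <= w k) -> uniq s ->
  (forall m, m \in s -> forall i, m ord0 i \in t) ->
  \sum_(m <- s) \prod_i w (m ord0 i) <= (\sum_(k <- t) w k) ^+ n.
Proof.
move=> w0 us st.
pose pt (f : {ffun 'I_n -> 'I_(size t)}) : 'rV[int]_n := \row_i t`_(f i).
apply: (@le_trans _ _ (\sum_(m <- [seq pt f | f : {ffun 'I_n -> 'I_(size t)}])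
    \prod_i w (m ord0 i))).
  apply: ler_sum_subset => // [m|m /st mt]; first exact: prodr_ge0.
  have mt' i : (index (m ord0 i) t < size t)%N by rewrite index_mem.
  apply/mapP; exists [ffun i => Ordinal (mt' i)]; first by rewrite mem_enum.
  by apply/rowP => i; rewrite mxE ffunE /= nth_index.
rewrite big_image /=.
have -> : (\sum_(k <- t) w k) ^+ n = \prod_(i < n) \sum_(j < size t) w t`_j.
  by rewrite prodr_const card_ord (big_nth 0) big_mkord.
rewrite bigA_distr_bigA /=.
by apply: ler_sum => f _; apply: ler_prod => i _; rewrite mxE w0 lexx.
Qed.

Lemma abs_coord_le_enorm (x : 'rV[R]_n) i : `|x ord0 i| <= enorm x.
Proof.
rewrite -sqrtr_sqr ler_sqrt ?sumr_ge0// => [|j _]; last exact: sqr_ge0.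
by rewrite (bigD1 i)//= lerDl sumr_ge0// => j _; exact: sqr_ge0.
Qed.

(** Each factor [1 + |m_i|] is at most [1 + |m|], so the decay in [|m|] is bounded
    by a product of [n] one-dimensional decays with exponent [1 + d / n]. *)
Lemma lattice_summable_powR (d C : R) (F : 'rV[int]_n -> R) :
  (0 < n)%N -> 0 < d -> (forall m, 0 <= F m) ->
  (forall m, F m <= C * (1 + enorm (int_rV R m)) `^ (- n%:R - d)) ->
  lattice_summable F.
Proof.
move=> n0 d0 F0 FC.
have n0' : 0 < n%:R :> R by rewrite ltr0n.
have C0 : 0 <= C.
  have := le_trans (F0 0) (FC 0); rewrite pmulr_lge0// powR_gt0//.
  by rewrite ltr_wpDr// sqrtr_ge0.
pose e := d / n%:R; have e0 : 0 < e by rewrite divr_gt0.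
pose w (k : int) : R := (1 + `|k%:~R|) `^ (- 1 - e).
have w0 k : 0 <= w k by exact: powR_ge0.
have Fw m : F m <= C * \prod_i w (m ord0 i).
  apply: le_trans (FC m) _; apply: ler_wpM2l => //.
  have -> : - n%:R - d = (- 1 - e) * n%:R by rewrite /e; field; rewrite gt_eqF.
  rewrite powRrM powR_mulrn ?powR_ge0// -[X in _ ^+ X]card_ord -prodr_const.
  apply: ler_prod => i _; rewrite powR_ge0/= /w.
  have h1 : 0 < 1 + `|(m ord0 i)%:~R| :> R by rewrite ltr_wpDr.
  have h2 : 1 + `|(m ord0 i)%:~R| <= 1 + enorm (int_rV R m).
    by rewrite lerD2l; have := abs_coord_le_enorm (int_rV R m) i; rewrite mxE.
  have h3 : 0 < 1 + enorm (int_rV R m) by apply: lt_le_trans h2.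
  rewrite -opprD !powRN lef_pV2 ?posrE ?powR_gt0//.
  by rewrite ge0_ler_powR ?nnegrE ?addr_ge0 ?sqrtr_ge0 ?(ltW e0).
apply: nondecreasing_is_cvgn.
  apply: nondecreasing_series => k _ _; rewrite /lattice_seq.
  by case: pickle_inv => //=.
exists (C * (2 * (1 + e^-1)) ^+ n) => _ [N _ <-]; rewrite series_lattice_seq.
set s := pmap _ _.
apply: (@le_trans _ _ (\sum_(m <- s) C * \prod_i w (m ord0 i))).
  exact: ler_sum.
rewrite -mulr_sumr ler_wpM2l//.
pose B := (\max_(m <- s) \max_i `|m ord0 i|)%N.
apply: le_trans (sum_prod_coord_le w0 _ _) _; last first.
- apply: lerXn2r; rewrite ?nnegrE; last exact: (sum_int_powR_le B e0).
    by rewrite sumr_ge0// => k _.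
  by rewrite mulr_ge0// addr_ge0// invr_ge0 ltW.
- move=> m ms i.
  have mB : (`|m ord0 i| <= B)%N.
    rewrite /B (big_rem m)//= leq_max; apply/orP; left.
    exact: (leq_bigmax i (F := fun i => `|m ord0 i|%N)).
  rewrite mem_cat; case: (m ord0 i) mB => k kB; apply/orP; [left|right].
    by apply: map_f; rewrite mem_iota add0n ltnS; exact: kB.
  by apply: map_f; rewrite mem_iota add0n ltnS; exact: (ltnW kB).
- by rewrite (pmap_uniq (@pickle_invK _))// iota_uniq.
Qed.

End lattice_sums.

(** * Dominated series and the real part of a complex exponential *)

Section tannery.
Variable R : realType.

Lemma is_cvg_series_dominated (u M : nat -> R) :
  (forall k, `|u k| <= M k) -> cvgn (series M) -> cvgn (series u).
Proof.
move=> uM cM; apply: normed_cvg; apply: series_le_cvg cM => //= k.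
exact: le_trans (normr_ge0 _) (uM k).
Qed.

Lemma norm_lim_series_le (u M : nat -> R) :
  (forall k, `|u k| <= M k) -> cvgn (series M) ->
  `|limn (series u)| <= limn (series M).
Proof.
move=> uM cM; have cu : cvgn [normed series u].
  apply: series_le_cvg cM => //= k; exact: le_trans (normr_ge0 _) (uM k).
by apply: le_trans (lim_series_norm cu) _; exact: lim_series_le.
Qed.

(** Dominated convergence for series: the tail is small uniformly in the
    parameter, and the finite head tends to zero term by term. *)
Lemma cvg_series_dominated0 (T : Type) (F : set_system T) {FF : Filter F}
    (u : nat -> T -> R) (M : nat -> R) :
  (forall k h, `|u k h| <= M k) -> cvgn (series M) ->
  (forall k, u k h @[h --> F] --> 0) ->
  limn (series (u ^~ h)) @[h --> F] --> 0.
Proof.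
move=> uM cM u0; apply/cvgr0Pnorm_lt => e e0.
have e2 : 0 < e / 2 by rewrite divr_gt0.
have [N _ hN] : \forall N \near \oo, `|limn (series M) - series M N| < e / 2.
  by move/cvgrPdist_lt : cM; exact.
have tail h : `|limn (series (u ^~ h)) - series (u ^~ h) N| < e / 2.
  apply: le_lt_trans (hN N (leqnn N)).
  have ccu : cvgn (series (u ^~ h)) by apply: is_cvg_series_dominated cM.
  have cu' : (fun n => `|series (u ^~ h) n - series (u ^~ h) N|) @ \oo -->
             `|limn (series (u ^~ h)) - series (u ^~ h) N|.
    by apply: cvg_norm; apply: cvgB => //; exact: cvg_cst.
  have cM' : (fun n => `|series M n - series M N|) @ \oo -->
             `|limn (series M) - series M N|.
    by apply: cvg_norm; apply: cvgB => //; exact: cvg_cst.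
  apply: ler_cvg_to cu' cM' _; near=> n.
  have Nn : (N <= n)%N by near: n; exact: nbhs_infty_ge.
  rewrite !sub_series Nn; apply: le_trans (ler_norm_sum _ _ _) _.
  by apply: le_trans (ler_norm _); exact: ler_sum.
have head : series (u ^~ h) N @[h --> F] --> 0.
  have -> : 0 = \sum_(0 <= k < N) 0 :> R by rewrite big1.
  by apply: cvg_big => [|k _]; [exact: add_continuous|exact: u0].
move/cvgr0Pnorm_lt : head => /(_ _ e2); apply: filterS => h hh.
rewrite -(subrK (series (u ^~ h) N) (limn _)).
by rewrite (splitr e); apply: le_lt_trans (ler_normD _ _) (ltrD _ _).
Unshelve. all: by end_near. Qed.

End tannery.

Section rexp.
Variable R : realType.
Implicit Types (c : R[i]) (t : R).

(** The real part of [c * e^(i t)]. *)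
Definition rexp c t : R := complex.Re c * cos t - complex.Im c * sin t.

Definition ell1 c : R := `|complex.Re c| + `|complex.Im c|.

Lemma ell1_ge0 c : 0 <= ell1 c. Proof. exact: addr_ge0. Qed.

Lemma norm_rexp_le c t : `|rexp c t| <= ell1 c.
Proof.
apply: le_trans (ler_normB _ _) _; rewrite !normrM.
by apply: lerD; rewrite ler_piMr ?cos_max ?sin_max.
Qed.

(** The product of [c] by the imaginary number [a * i]. *)
Definition mul_imag (a : R) c : R[i] :=
  (- (a * complex.Im c) +i* (a * complex.Re c))%C.

Lemma ell1_mul_imag a c : ell1 (mul_imag a c) = `|a| * ell1 c.
Proof. by rewrite /ell1 /= normrN !normrM addrC mulrDr. Qed.

Lemma mul_imagC a b c : mul_imag a (mul_imag b c) = mul_imag b (mul_imag a c).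
Proof. by rewrite /mul_imag /=; congr (_ +i* _)%C; ring. Qed.

Lemma is_derive_rexp_affine c (t a h : R) :
  is_derive h 1 (fun h => rexp c (t + h * a)) (rexp (mul_imag a c) (t + h * a)).
Proof.
have da : is_derive h 1 (fun h => t + h * a) a.
  have -> : (fun h => t + h * a) = cst t + (a \*: id).
    by apply/funext => x /=; rewrite [in LHS]mulrC.
  have d0 : is_derive h 1 (cst t + (a \*: id)) (0 + a *: (1 : R)).
    by apply: is_deriveD; apply: is_deriveZ.
  by rewrite add0r [_ *: _]mulr1 in d0.
have dc : is_derive h 1 (fun h => cos (t + h * a)) (- sin (t + h * a) * a).
  by apply: (@is_derive1_comp _ cos).
have ds : is_derive h 1 (fun h => sin (t + h * a)) (cos (t + h * a) * a).
  by apply: (@is_derive1_comp _ sin).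
have d0 : is_derive h 1
    ((complex.Re c \*: (fun h => cos (t + h * a))) -
     (complex.Im c \*: (fun h => sin (t + h * a))))
    (complex.Re c *: (- sin (t + h * a) * a) -
     complex.Im c *: (cos (t + h * a) * a)).
  by apply: is_deriveB; apply: is_deriveZ.
apply: (is_derive_eq d0).
by rewrite /rexp /= /GRing.scale /=; ring.
Qed.

Lemma norm_rexpB_le c t t' : `|rexp c t - rexp c t'| <= ell1 c * `|t - t'|.
Proof.
wlog : t t' / t' <= t => [hw|tt'].
  have [|/ltW] := leP t' t => h; first exact: hw.
  by rewrite distrC [X in _ * X]distrC; exact: hw.
have dr (x : R) : is_derive x 1 (rexp c) (rexp (mul_imag 1 c) x).
  have := is_derive_rexp_affine c 0 1 x; rewrite add0r mulr1.
  by rewrite (_ : (fun h => _) = rexp c)//; apply/funext => y; rewrite add0r mulr1.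
have [|x _ ->] := @MVT_segment R (rexp c) (rexp (mul_imag 1 c)) t' t tt'.
  apply: continuous_subspaceT => x; apply: differentiable_continuous.
  by apply/derivable1_diffP; exact: (@ex_derive _ _ _ _ _ _ _ (dr x)).
rewrite normrM ler_wpM2r//; apply: le_trans (norm_rexp_le _ _) _.
by rewrite ell1_mul_imag normr1 mul1r.
Qed.

Lemma cvg_rexp_quotient c (t a : R) :
  h^-1 * (rexp c (t + h * a) - rexp c t) @[h --> (0 : R)^'] --> rexp (mul_imag a c) t.
Proof.
have [d1 d2] := is_derive_rexp_affine c t a 0.
move: d2; rewrite mul0r addr0 => <-.
rewrite /derive.
have -> : (fun h : R => h^-1 * (rexp c (t + h * a) - rexp c t)) =
  (fun h : R => h^-1 *: (((fun h0 : R => rexp c (t + h0 * a)) \o shift 0) (h *: 1)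
     - rexp c (t + 0 * a))).
  by apply/funext => h; rewrite /= scaler1 addr0 mul0r addr0.
exact: d1.
Qed.

End rexp.

(** * Trigonometric series: derivatives and Hoelder continuity *)

Section fourier_series.
Variables (R : realType) (n : nat) (om : R).
Implicit Types (c : 'rV[int]_n -> R[i]) (m : 'rV[int]_n) (x : 'rV[R]_n).
Implicit Types (w : seq 'I_n) (p : R).

Lemma lattice_seq_le (F : 'rV[int]_n -> R) (B : 'rV[int]_n -> R) k :
  (forall m, `|F m| <= B m) -> `|lattice_seq F k| <= lattice_seq B k.
Proof. by move=> FB; rewrite /lattice_seq; case: pickle_inv => //=; rewrite normr0. Qed.

Lemma lattice_seqZ (F : 'rV[int]_n -> R) a :
  lattice_seq (fun m => a * F m) = a *: lattice_seq F.
Proof.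
apply/funext => k; rewrite -[RHS]/(a * lattice_seq F k) /lattice_seq.
by case: pickle_inv => //=; rewrite mulr0.
Qed.

Lemma lattice_seqB (F F' : 'rV[int]_n -> R) :
  lattice_seq (fun m => F m - F' m) = lattice_seq F - lattice_seq F'.
Proof.
apply/funext => k; rewrite /lattice_seq !fctE.
by case: pickle_inv => //=; rewrite subr0.
Qed.

Definition summable_coef c := lattice_summable (fun m => ell1 (c m)).

Definition phase m x : R := om * dotr (int_rV R m) x.

Definition fterm c x m : R := rexp (c m) (phase m x).

Definition fseries c x : R := limn (series (lattice_seq (fterm c x))).

Lemma is_cvg_fseries c x : summable_coef c ->
  cvgn (series (lattice_seq (fterm c x))).
Proof.
apply: is_cvg_series_dominated => k; apply: lattice_seq_le => m.
exact: norm_rexp_le.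
Qed.

Lemma phaseD m x (h : 'rV[R]_n) : phase m (h + x) = phase m x + phase m h.
Proof.
rewrite /phase -mulrDr; congr (_ * _); rewrite -big_split /=.
by apply: eq_bigr => i _; rewrite !mxE mulrDr addrC.
Qed.

Lemma phase_addm m m' x : phase (m + m') x = phase m x + phase m' x.
Proof.
rewrite /phase -mulrDr; congr (_ * _); rewrite -big_split /=.
by apply: eq_bigr => i _; rewrite !mxE rmorphD mulrDl.
Qed.

Lemma phase_oppm m x : phase (- m) x = - phase m x.
Proof.
rewrite /phase -mulrN; congr (_ * _); rewrite -sumrN.
by apply: eq_bigr => i _; rewrite !mxE rmorphN mulNr.
Qed.

Lemma phase_scale_delta m (a : R) j :
  phase m (a *: delta_mx ord0 j) = a * (om * (m ord0 j)%:~R).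
Proof.
rewrite /phase /dotr (bigD1 j)//= big1 => [|i ij].
  by rewrite !mxE !eqxx /=; ring.
by rewrite !mxE (negbTE ij) andbF !mulr0.
Qed.

(** Coefficients of the formal derivative in the [j]-th coordinate. *)
Definition dcoef j c m : R[i] := mul_imag (om * (m ord0 j)%:~R) (c m).

(** Termwise differentiation; the difference quotients are dominated by the
    coefficients of the derived series because [rexp] is Lipschitz. *)
Lemma is_derive_fseries c j x : summable_coef c -> summable_coef (dcoef j c) ->
  is_derive x (delta_mx ord0 j) (fseries c) (fseries (dcoef j c) x).
Proof.
move=> sc sdc; set D := fseries (dcoef j c) x.
pose r m (h : R) := h^-1 * (fterm c (h *: delta_mx ord0 j + x) m - fterm c x m)
  - fterm (dcoef j c) x m.
have rE h : h^-1 *: (fseries c (h *: delta_mx ord0 j + x) - fseries c x) - D =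
    limn (series (lattice_seq (r ^~ h))).
  rewrite /r lattice_seqB lattice_seqZ lattice_seqB.
  have cB : cvgn (series (lattice_seq (fterm c (h *: delta_mx ord0 j + x)) -
      lattice_seq (fterm c x))).
    by apply: is_cvg_seriesB; exact: is_cvg_fseries.
  rewrite lim_seriesB; [|exact: is_cvg_seriesZ|exact: is_cvg_fseries].
  rewrite lim_seriesZ//; congr (_ *: _ - _).
  by rewrite lim_seriesB//; exact: is_cvg_fseries.
have hD : h^-1 *: (fseries c (h *: delta_mx ord0 j + x) - fseries c x)
    @[h --> (0 : R)^'] --> D.
  apply: cvg_zero.
  rewrite (_ : _ - cst D = fun h => limn (series (lattice_seq (r ^~ h)))); last first.
    by apply/funext => h; rewrite -rE !fctE.
  apply: (@cvg_series_dominated0 _ _ _ _ (fun k h => lattice_seq (r ^~ h) k)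
      (lattice_seq (fun m => 2 * ell1 (dcoef j c m)))).
  - move=> k h; apply: lattice_seq_le => m; rewrite /r.
    rewrite mulr2n mulrDl mul1r; apply: le_trans (ler_normB _ _) _.
    apply: lerD; last exact: norm_rexp_le.
    rewrite /fterm phaseD phase_scale_delta /dcoef ell1_mul_imag normrM.
    have [->|h0] := eqVneq h 0.
      by rewrite invr0 normr0 mul0r mulr_ge0// ell1_ge0.
    rewrite normfV ler_pdivrMl ?normr_gt0//.
    apply: le_trans (norm_rexpB_le _ _ _) _.
    by rewrite addrAC subrr add0r normrM [leRHS]mulrC -mulrA [leRHS]mulrC -mulrA.
  - by rewrite lattice_seqZ; exact: is_cvg_seriesZ.
  - move=> k; rewrite /lattice_seq; case: pickle_inv => [m|] /=; last exact: cvg_cst.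
    rewrite -[X in _ --> X](subrr (fterm (dcoef j c) x m)).
    apply: cvgB; last exact: cvg_cst.
    rewrite /fterm; under eq_cvg do rewrite phaseD phase_scale_delta.
    exact: cvg_rexp_quotient.
apply: DeriveDef; first by apply/cvg_ex; exists D.
exact: cvg_lim.
Qed.

(** Coefficients of [-i] times the series: the imaginary part of a series is
    the real part of its product by [-i]. *)
Definition rotc c m : R[i] := mul_imag (-1) (c m).

Definition cfseries c x : R[i] := (fseries c x +i* fseries (rotc c) x)%C.

Lemma summable_rotc c : summable_coef c -> summable_coef (rotc c).
Proof.
rewrite /summable_coef => sc; rewrite (_ : (fun m => _) = fun m => ell1 (c m))//.
by apply/funext => m; rewrite ell1_mul_imag normrN1 mul1r.
Qed.

Lemma dcoef_rotc j c : dcoef j (rotc c) = rotc (dcoef j c).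
Proof. by apply/funext => m; rewrite /dcoef /rotc mul_imagC. Qed.

Lemma cfseries_derivable c j : summable_coef c -> summable_coef (dcoef j c) ->
  partial_derivable j (cfseries c).
Proof.
move=> sc sdc x; split.
  by have [] := is_derive_fseries x sc sdc.
have sr := summable_rotc sc; have := summable_rotc sdc.
by rewrite -dcoef_rotc => sdr; have [] := is_derive_fseries x sr sdr.
Qed.

Lemma partial_cfseries c j : summable_coef c -> summable_coef (dcoef j c) ->
  partial j (cfseries c) = cfseries (dcoef j c).
Proof.
move=> sc sdc; apply/funext => x; rewrite /partial /cfseries; congr (_ +i* _)%C.
  by have [] := is_derive_fseries x sc sdc.
have sr := summable_rotc sc; have := summable_rotc sdc.
by rewrite -dcoef_rotc => sdr; have [] := is_derive_fseries x sr sdr.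
Qed.

Definition lattice_weight m : R := 1 + enorm (int_rV R m).

Lemma lattice_weight_ge1 m : 1 <= lattice_weight m.
Proof. by rewrite lerDl sqrtr_ge0. Qed.

Lemma lattice_weight_gt0 m : 0 < lattice_weight m.
Proof. exact: lt_le_trans (lattice_weight_ge1 m). Qed.

Definition decays p c :=
  exists A, forall m, ell1 (c m) <= A * lattice_weight m `^ (- n%:R - p).

Lemma decays_summable p c : (0 < n)%N -> 0 < p -> decays p c -> summable_coef c.
Proof.
move=> n0 p0 [A cA]; apply: (lattice_summable_powR n0 p0 _ cA) => m.
exact: ell1_ge0.
Qed.

Lemma decays_rotc p c : decays p c -> decays p (rotc c).
Proof. by move=> [A cA]; exists A => m; rewrite ell1_mul_imag normrN1 mul1r. Qed.

Lemma coord_le_weight m j : `|(m ord0 j)%:~R| <= lattice_weight m.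
Proof.
have := abs_coord_le_enorm (int_rV R m) j; rewrite mxE => /le_trans; apply.
by rewrite lerDr.
Qed.

Lemma decays_dcoef p c j : decays p c -> decays (p - 1) (dcoef j c).
Proof.
move=> [A cA]; exists (`|om| * A) => m; rewrite ell1_mul_imag normrM.
have w0 := lattice_weight_gt0 m.
have -> : - n%:R - (p - 1) = 1 + (- n%:R - p) :> R by ring.
rewrite powRD; last by rewrite (gt_eqF w0) implybT.
rewrite powRr1 ?(ltW w0)// -!mulrA ler_wpM2l// mulrCA.
by apply: ler_pM => //; [exact: ell1_ge0|exact: coord_le_weight].
Qed.

Definition wcoef w c := foldl (fun c j => dcoef j c) c w.

Lemma perm_wcoef w w' c : perm_eq w w' -> wcoef w c = wcoef w' c.
Proof.
have dC i j d : dcoef i (dcoef j d) = dcoef j (dcoef i d).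
  by apply/funext => m; rewrite /dcoef mul_imagC.
have wE v : forall d i, wcoef v (dcoef i d) = dcoef i (wcoef v d).
  by elim: v => //= j v IHv d i; rewrite dC IHv.
have wC v1 v2 : forall d, wcoef v1 (wcoef v2 d) = wcoef v2 (wcoef v1 d).
  elim: v2 => //= j v2 IHv d.
  by rewrite -/(wcoef v2 _) -/(wcoef v2 (wcoef _ _)) IHv wE.
move=> ww'; apply/esym.
apply: (@catCA_perm_ind _ (fun v => wcoef v c = wcoef w c) _ w) => //.
move=> s1 s2 s3; rewrite /wcoef !foldl_cat => <-; congr foldl.
exact: wC.
Qed.

(** Each derivative costs one power of [|m|]. *)
Lemma decays_wcoef w p c : decays p c -> decays (p - (size w)%:R) (wcoef w c).
Proof.
elim: w p c => [|j w IHw] p c dc /=; first by rewrite subr0.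
have -> : p - (size w).+1%:R = p - 1 - (size w)%:R by rewrite -natr1; ring.
by apply: IHw; exact: decays_dcoef.
Qed.

Lemma word_partial_cfseries w p c : (0 < n)%N -> (size w)%:R < p -> decays p c ->
  word_derivable w (cfseries c) /\
  word_partial w (cfseries c) = cfseries (wcoef w c).
Proof.
move=> n0; elim: w p c => [//|j w IHw] p c /= wp dc.
have wp1 : (size w)%:R < p - 1 by rewrite ltrBrDr natr1.
have p1 : 0 < p - 1 by exact: le_lt_trans wp1.
have p0 : 0 < p by rewrite (lt_trans p1)// gtrBl.
have ddc := decays_dcoef j dc.
have sc := decays_summable n0 p0 dc; have sdc := decays_summable n0 p1 ddc.
have [wd we] := IHw _ _ wp1 ddc.
rewrite /word_partial /= (partial_cfseries sc sdc).
exact: (conj (conj (cfseries_derivable sc sdc) wd) we).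
Qed.

Lemma phase_norm_le m (h : 'rV[R]_n) :
  `|phase m h| <= `|om| * n%:R * (lattice_weight m * enorm h).
Proof.
rewrite /phase normrM -!mulrA ler_wpM2l//.
apply: le_trans (ler_norm_sum _ _ _) _.
rewrite -[n in n%:R]card_ord mulr_natl -sumr_const; apply: ler_sum => i _.
rewrite normrM mxE; apply: ler_pM => //; first exact: coord_le_weight.
exact: abs_coord_le_enorm.
Qed.

(** [min(2, d) <= 2 d^g] interpolates between boundedness and the Lipschitz
    bound. *)
Lemma norm_rexpB_powR (z : R[i]) (t t' g : R) : 0 < g <= 1 ->
  `|rexp z t - rexp z t'| <= 2 * ell1 z * `|t - t'| `^ g.
Proof.
move=> /andP[g0 g1]; have z0 := ell1_ge0 z.
have [d1|d1] := leP `|t - t'| 1.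
  apply: le_trans (norm_rexpB_le _ _ _) _.
  have [->|d0] := eqVneq `|t - t'| 0; first by rewrite mulr0 !mulr_ge0 ?powR_ge0.
  have dp : 0 < `|t - t'| by rewrite lt_neqAle eq_sym d0 /=.
  have : `|t - t'| <= `|t - t'| `^ g by rewrite ger1_powR// dp.
  move=> dg; apply: ler_pM => //; first by rewrite ler_peMl// ler1n.
apply: (@le_trans _ _ (2 * ell1 z)).
  rewrite mulr2n mulrDl mul1r; apply: le_trans (ler_normB _ _) _.
  by apply: lerD; exact: norm_rexp_le.
rewrite ler_peMr ?mulr_ge0// -(powRr0 `|t - t'|); apply: ler_powR; exact: ltW.
Qed.

(** The increment of the term of index [m] is at most a constant times
    [|c_m| (|m| |h|) ^ g], which is summable over the lattice when [g < p]. *)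
Lemma fseries_hoelder p g c : (0 < n)%N -> 0 < g -> g <= 1 -> g < p -> decays p c ->
  exists K, forall x h, `|fseries c (x + h) - fseries c x| <= K * enorm h `^ g.
Proof.
move=> n0 g0 g1 gp dc.
have sc := decays_summable n0 (lt_trans g0 gp) dc.
pose b m := 2 * ell1 (c m) * (`|om| * n%:R * lattice_weight m) `^ g.
have sb : lattice_summable b.
  case: dc => A cA.
  have gp' : 0 < p - g by rewrite subr_gt0.
  apply: (lattice_summable_powR (C := 2 * A * (`|om| * n%:R) `^ g) n0 gp') => m.
    by rewrite !mulr_ge0 ?powR_ge0 ?ell1_ge0.
  have w0 := lattice_weight_gt0 m; rewrite -/(lattice_weight m).
  have -> : - n%:R - (p - g) = (- n%:R - p) + g :> R by ring.
  rewrite powRD; last by rewrite (gt_eqF w0) implybT.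
  rewrite /b powRM ?mulr_ge0 ?(ltW w0)// -!mulrA ler_wpM2l//.
  rewrite [leRHS](_ : _ = A * lattice_weight m `^ (- n%:R - p) *
    ((`|om| * n%:R) `^ g * lattice_weight m `^ g)); last by ring.
  by rewrite ler_wpM2r ?mulr_ge0 ?powR_ge0.
exists (limn (series (lattice_seq b))) => x h.
rewrite -lim_seriesB; try exact: is_cvg_fseries.
rewrite -lattice_seqB mulrC.
have -> : enorm h `^ g * limn (series (lattice_seq b)) =
    limn (series (lattice_seq (fun m => enorm h `^ g * b m))).
  by rewrite lattice_seqZ lim_seriesZ.
apply: norm_lim_series_le; last by rewrite lattice_seqZ; exact: is_cvg_seriesZ.
move=> k; apply: lattice_seq_le => m.
have g01 : 0 < g <= 1 by rewrite g0.
apply: le_trans (norm_rexpB_powR _ _ _ g01) _.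
rewrite (addrC x h) phaseD [phase m x + _]addrC addrK.
rewrite [leRHS]mulrC /b -[leRHS]mulrA ler_wpM2l ?mulr_ge0 ?ell1_ge0//.
rewrite -powRM ?mulr_ge0 ?sqrtr_ge0 ?(ltW (lattice_weight_gt0 _))//.
have wh0 : 0 <= `|om| * n%:R * lattice_weight m * enorm h.
  by rewrite !mulr_ge0 ?sqrtr_ge0 ?(ltW (lattice_weight_gt0 _)).
apply: ge0_ler_powR; rewrite ?nnegrE ?(ltW g0)//.
by rewrite -[leRHS]mulrA; exact: phase_norm_le.
Qed.

End fourier_series.

(** * Lebesgue measure on row vectors and orthogonality of characters *)

Section cube_measure.
Variable R : realType.

Lemma measurable_rV_box n (A : 'I_n -> set (measurableTypeR R)) :
  (forall i, measurable (A i)) ->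
  measurable [set x : 'rV[R]_n | forall i, A i (x ord0 i)].
Proof.
move=> mA; rewrite (_ : mkset _ = \big[setI/setT]_(i < n) (rV_coor i @^-1` A i)).
  apply: bigsetI_measurable => i _; rewrite -[X in measurable X]setTI.
  exact: measurable_rV_coor.
apply/seteqP; split => x /=; rewrite -bigcap_seq => Ax i //.
  by move=> _; exact: Ax.
by apply: (Ax i); rewrite /= mem_index_enum.
Qed.

Lemma cube_box n (r : R) : [set x : 'rV[R]_n | forall i, `|x ord0 i| <= r] =
  [set x | forall i, (`[- r, r]%classic : set (measurableTypeR R)) (x ord0 i)].
Proof.
by apply/seteqP; split => x /= xr i; have := xr i; rewrite in_itv/= ler_norml.
Qed.

Lemma measurable_cube n (r : R) :
  measurable [set x : 'rV[R]_n | forall i, `|x ord0 i| <= r].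
Proof. by rewrite cube_box; apply: (@measurable_rV_box _ (fun=> `[- r, r]%classic)). Qed.

Lemma lebesgue_rV_cube n (r : R) : 0 <= r ->
  lebesgue_rV R n [set x : 'rV[R]_n | forall i, `|x ord0 i| <= r] = ((r *+ 2) ^+ n)%:E.
Proof.
move=> r0; rewrite cube_box (@lebesgue_rV_box _ _ (fun=> `[- r, r]%classic))//.
rewrite (eq_bigr (fun=> (r *+ 2)%:E)) => [|i _].
  by rewrite prodEFin prodr_const card_ord.
rewrite lebesgue_measure_itv/= lte_fin; case: ltP => [_|rr].
  by rewrite -EFinB opprK mulr2n.
by rewrite (_ : r = 0) ?mul0rn//; apply/eqP; rewrite eq_le r0 andbT; lra.
Qed.

Lemma sigma_finite_lebesgue_rV n : sigma_finite setT (lebesgue_rV R n).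
Proof.
exists (fun k => [set x : 'rV[R]_n | forall i, `|x ord0 i| <= k%:R]).
  apply/seteqP; split => // x _.
  have [k hk] : exists k : nat, enorm x <= k%:R.
    by exists (Num.bound (enorm x)); rewrite ltW// archi_boundP// sqrtr_ge0.
  exists k => //= i; apply: le_trans hk; exact: abs_coord_le_enorm.
move=> k; split; first exact: measurable_cube.
by rewrite lebesgue_rV_cube// ltry.
Qed.

(** The measure itself, under a name whose arguments include a proof of its
    sigma-finiteness, so that the corresponding structure can be attached. *)
Definition sigma_finite_copy d (T : measurableType d)
  (mu : {measure set T -> \bar R}) of sigma_finite setT mu : set T -> \bar R := mu.

HB.instance Definition _ d (T : measurableType d)
    (mu : {measure set T -> \bar R}) (sf : sigma_finite setT mu) :=
  Measure.copy (sigma_finite_copy sf) mu.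

HB.instance Definition _ d (T : measurableType d)
    (mu : {measure set T -> \bar R}) (sf : sigma_finite setT mu) :=
  Measure_isSigmaFinite.Build d T R (sigma_finite_copy sf) sf.

(** The measure in dimension [n + 1] is the image under [rV_cons] of a product,
    so Tonelli integrates the first coordinate out. *)
Lemma integral_lebesgue_rVS n (f : 'rV[R]_n.+1 -> \bar R) :
  measurable_fun [set: 'rV[R]_n.+1] f -> (forall x, 0 <= f x)%E ->
  (\int[lebesgue_rV R n.+1]_x f x =
   \int[lebesgue_rV R n]_x \int[@lebesgue_measure R]_t f (rV_cons (x, t)))%E.
Proof.
move=> mf f0; rewrite /= /lebesgue_rVS.
rewrite (@ge0_integral_pushforward _ _ _ _ _ (@rV_cons R n)) //; last first.
  exact: measurable_rV_cons.
rewrite preimage_setT.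
apply: (@fubini_tonelli1 _ _ _ _ _
  (sigma_finite_copy (sigma_finite_lebesgue_rV n)) _ _ _ (fun=> f0 _)).
by apply: measurableT_comp => //; exact: measurable_rV_cons.
Qed.

Lemma sin_int_pi (k : int) : sin (k%:~R * pi) = 0 :> R.
Proof.
have sn j : sin (j%:R * pi) = 0 :> R.
  elim: j => [|j IHj]; first by rewrite mul0r sin0.
  by rewrite -natr1 mulrDl mul1r sinD IHj sinpi mul0r mulr0 addr0.
case: k => k; first exact: sn.
by rewrite NegzE mulrNz mulNr sinN sn oppr0.
Qed.

Lemma integral_cos_affine (r b t0 : R) : 0 < r -> b != 0 ->
  (\int[@lebesgue_measure R]_(t in `[(- r)%R, r]) (1 + cos (t * b + t0))%:E =
   (r *+ 2 + cos t0 * sin (r * b) *+ 2 / b)%:E)%E.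
Proof.
move=> r0 b0; pose F t : R := t + b^-1 * sin (t * b + t0).
have dF (t : R) : is_derive t 1 F (1 + cos (t * b + t0)).
  (* [rexp (0 -i* 1)] is the sine. *)
  have dr := is_derive_rexp_affine (0 -i* 1)%C t0 b t.
  have d0 : is_derive t 1
      (id + (b^-1 \*: (fun h => rexp (0 -i* 1)%C (t0 + h * b))))
      (1 + b^-1 *: rexp (mul_imag b (0 -i* 1)%C) (t0 + t * b)).
    by apply: is_deriveD; apply: is_deriveZ.
  have -> : F = id + (b^-1 \*: (fun h => rexp (0 -i* 1)%C (t0 + h * b))).
    apply/funext => h; rewrite /F -[RHS]/(h + b^-1 * rexp _ _) /rexp /=.
    by rewrite [t0 + _]addrC; ring.
  apply: (is_derive_eq d0); rewrite -[b^-1 *: _]/(b^-1 * _) /rexp /=.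
  by rewrite [t0 + _]addrC; field.
have cF : continuous F.
  move=> t; apply: differentiable_continuous.
  by apply/derivable1_diffP; exact: (@ex_derive _ _ _ _ _ _ _ (dF t)).
have cf : continuous (fun t : R => 1 + cos (t * b + t0)).
  move=> t; apply: cvgD; first exact: cvg_cst.
  apply: continuous_comp; last exact: continuous_cos.
  by apply: cvgD; [apply: cvgMl; exact: cvg_id|exact: cvg_cst].
have rr : - r < r by rewrite gt0_cp.
rewrite (@continuous_FTC2 _ (fun t : R => 1 + cos (t * b + t0)) F)//.
- rewrite -EFinB; congr (_%:E); rewrite /F mulNr [- (r * b) + _]addrC sinB sinD.
  by rewrite mulr2n; field.
- exact: continuous_subspaceT.
- split.
  + by move=> t _; exact: (@ex_derive _ _ _ _ _ _ _ (dF t)).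
  + by apply: cvg_at_right_filter; exact: cF.
  + by apply: cvg_at_left_filter; exact: cF.
- by move=> t _; rewrite derive1E; exact: (@derive_val _ _ _ _ _ _ _ (dF t)).
Qed.

Lemma measurable_phase n om (m : 'rV[int]_n) :
  measurable_fun [set: 'rV[R]_n] (phase om m).
Proof.
apply: measurable_funM => //; apply: measurable_sum => i.
by apply: measurable_funM => //; exact: measurable_rV_coor.
Qed.

Lemma measurable_cos_phase n om (m : 'rV[int]_n) (t0 : R) :
  measurable_fun [set: 'rV[R]_n] (fun x => cos (phase om m x + t0)).
Proof.
apply: (measurableT_comp (f := @cos R)).
  exact: continuous_measurable_fun (@continuous_cos R).
by apply: measurable_funD => //; exact: measurable_phase.
Qed.

(** Orthogonality of the characters. Adding [1] keeps the integrand nonnegative,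
    so that Tonelli applies and one coordinate can be integrated at a time. *)
Lemma integral_cube_cos1 n (om r : R) (m : 'rV[int]_n) (t0 : R) : 0 < r ->
  (forall k : int, sin (r * (om * k%:~R)) = 0) -> om != 0 ->
  (\int[lebesgue_rV R n]_(x in [set x : 'rV[R]_n | forall i, (`|x ord0 i| <= r)%R])
    (1 + cos (phase om m x + t0))%:E =
   ((r *+ 2) ^+ n * (1 + (m == 0)%:R * cos t0))%:E)%E.
Proof.
move=> r0 somk om0; elim: n m t0 => [|n IHn] m t0.
  rewrite expr0 mul1r (_ : m = 0) ?eqxx ?mul1r; last by apply/rowP => -[].
  rewrite /= integral_dirac; [|exact: measurable_cube|].
    by rewrite /phase /dotr big_ord0 mulr0 add0r diracE mem_set ?mul1e//= => -[].
  apply/measurable_EFinP/measurable_funD => //.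
  by apply: measurable_funTS; exact: measurable_cos_phase.
pose m' : 'rV[int]_n := \row_j m ord0 (lift ord0 j).
pose k := m ord0 ord0.
have phE x t : phase om m (rV_cons (x, t)) = t * (om * k%:~R) + phase om m' x.
  rewrite /phase /dotr big_ord_recl !mxE unlift_none /= mulrDr.
  congr (_ + _); first by rewrite /k; ring.
  by congr (_ * _); apply: eq_bigr => j _; rewrite !mxE liftK.
have cubeE x t : (forall i, `|(rV_cons (x, t) : 'rV[R]_n.+1) ord0 i| <= r) <->
    (forall i, `|x ord0 i| <= r) /\ `|t| <= r.
  split=> [h|[h1 h2] i].
    split=> [i|]; first by have := h (lift ord0 i); rewrite mxE liftK.
    by have := h ord0; rewrite mxE unlift_none.
  by rewrite mxE; case: unliftP => [j|] _ /=; [exact: h1|exact: h2].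
have mf0 : measurable_fun [set x : 'rV[R]_n.+1 | forall i, `|x ord0 i| <= r]
    (fun x => (1 + cos (phase om m x + t0))%:E).
  apply/measurable_EFinP/measurable_funD => //.
  by apply: measurable_funTS; exact: measurable_cos_phase.
rewrite integral_mkcond integral_lebesgue_rVS; last 2 first.
- have mC : measurable [set x : 'rV[R]_n.+1 | forall i, `|x ord0 i| <= r].
    exact: measurable_cube.
  by apply/(measurable_restrictT _ mC).
- move=> x; have := cos_geN1 (phase om m x + t0); rewrite /patch.
  by case: ifP => // _ c1; rewrite lee_fin -lerBlDl sub0r.
have kE : (m == 0) = (k == 0) && (m' == 0).
  apply/eqP/andP => [m0|[/eqP k0 /eqP m0]].
    by split; apply/eqP; [rewrite /k m0 mxE|apply/rowP => i; rewrite /m' m0 !mxE].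
  apply/rowP => i; rewrite mxE; have [j ->|->] := unliftP ord0 i => //.
  by have := congr1 (fun v : 'rV[int]_n => v ord0 j) m0; rewrite !mxE.
have inner (x : 'rV[R]_n) :
  (\int[@lebesgue_measure R]_(t in `[(- r)%R, r])
     (1 + cos (phase om m (rV_cons (x, t)) + t0))%:E =
   (r *+ 2 * (1 + (k == 0)%:R * cos (phase om m' x + t0)))%:E)%E.
  under eq_integral do rewrite phE -addrA.
  have [k0|k0] := eqVneq k 0.
    under eq_integral do rewrite k0 mulr0 mulr0 add0r.
    rewrite integral_cst//= lebesgue_measure_itv/= lte_fin gt0_cp//.
    by rewrite -EFinB opprK -EFinM mul1r mulrC mulr2n.
  rewrite integral_cos_affine ?mulf_neq0 ?intr_eq0//.
  by rewrite somk mulr0 mul0rn mul0r mul0r !addr0 mulr1.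
transitivity (\int[lebesgue_rV R n]_(x in [set x : 'rV[R]_n |
   forall i, (`|x ord0 i| <= r)%R])
   (r *+ 2 * (1 + (k == 0)%:R * cos (phase om m' x + t0)))%:E)%E.
  rewrite [RHS]integral_mkcond; congr (integral _ _ _); apply/funext => x.
  rewrite /patch.
  have [xr|xr] := pselect (forall i, `|x ord0 i| <= r); last first.
    rewrite memNset//; apply: integral0_eq => t _.
    by rewrite memNset// => /cubeE[].
  rewrite mem_set// -inner// [RHS]integral_mkcond; congr (integral _ _ _).
  apply/funext => t.
  rewrite /patch; have [tr|tr] := boolP (`|t| <= r).
    by rewrite !mem_set//=; [rewrite in_itv/= -ler_norml|apply/cubeE].
  rewrite !memNset//=; first by rewrite in_itv/= -ler_norml; exact/negP.
  by move=> /cubeE[_]; exact/negP.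
under eq_integral do rewrite EFinM.
have cosN1 (y : R) : 0 <= 1 + (k == 0)%:R * cos y.
  by have := cos_geN1 y; case: (k == 0); rewrite ?mul1r ?mul0r; lra.
rewrite ge0_integralZl_EFin; last first.
- by rewrite mulrn_wge0// ltW.
- apply/measurable_EFinP/measurable_funD => //; apply: measurable_funM => //.
  by apply: measurable_funTS; exact: measurable_cos_phase.
- by move=> x _; rewrite lee_fin.
- exact: measurable_cube.
rewrite kE; have [k0|k0] := eqVneq k 0; last first.
  under eq_integral do rewrite mul0r addr0.
  rewrite integral_cst ?lebesgue_rV_cube ?ltW//; last exact: measurable_cube.
  by rewrite mul1e -EFinM exprS mul0r addr0 mulr1.
under eq_integral do rewrite mul1r.
by rewrite IHn -EFinM exprS mulrA.
Qed.

End cube_measure.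

(** * Algebras of functions closed under bounded limits *)

Section bounded_algebra.
Variables (R : realType) (T : Type).

(** Closure under bounded pointwise limits makes such an algebra of functions
    that of the bounded functions measurable for some sigma-algebra. *)
Record bounded_algebra (M : (T -> R) -> Prop) : Prop := BoundedAlgebra {
  bounded_algebra_cst : forall c, M (fun=> c) ;
  bounded_algebraD : forall f g, M f -> M g -> M (fun x => f x + g x) ;
  bounded_algebraM : forall f g, M f -> M g -> M (fun x => f x * g x) ;
  bounded_algebra_lim : forall (f_ : nat -> T -> R) f B,
    (forall k, M (f_ k)) -> (forall k x, `|f_ k x| <= B) ->
    (forall x, f_ ^~ x @ \oo --> f x) -> M f }.

Lemma bernoulli_ge (x : R) k : -1 <= x -> 1 + k%:R * x <= (1 + x) ^+ k.
Proof.
move=> x1; elim: k => [|k IHk]; first by rewrite mul0r addr0 expr0.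
have x0 : 0 <= 1 + x by lra.
rewrite exprS; apply: le_trans (ler_wpM2l x0 IHk).
rewrite -natr1; have := ler0n R k; set j := k%:R => j0.
by rewrite -subr_ge0; have := mulr_ge0 j0 (sqr_ge0 x); nra.
Qed.

(** Polynomials stepping from [1] to [0] across [1/2]. The exponents are such
    that [2 ^ (k ^ 2 - k) * t ^ (k ^ 2)] is at most [2 ^ (- k)] for [t <= 1/2],
    and is [((2 * t) ^ k / 2) ^ k] in general. *)
Definition step_poly k (t : R) : R := (1 - t ^+ (k ^ 2)) ^+ (2 ^ (k ^ 2 - k)).

Lemma step_poly_itv k (t : R) : 0 <= t <= 1 -> 0 <= step_poly k t <= 1.
Proof.
move=> t01; have : 0 <= 1 - t ^+ (k ^ 2) <= 1.
  by case/andP: t01 => t0 t1; rewrite subr_ge0 exprn_ile1//= gerBl exprn_ge0.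
by move=> /andP[a0 a1]; rewrite exprn_ge0//= exprn_ile1.
Qed.

Lemma step_poly_exponent k (t : R) :
  (2 ^ (k ^ 2 - k))%:R * t ^+ (k ^ 2) = ((2 * t) ^+ k / 2) ^+ k.
Proof.
have kk : (k <= k ^ 2)%N by rewrite -mulnn; case: k => // k; rewrite leq_pmulr.
rewrite natrX expr_div_n -exprM mulnn exprMn mulrAC; congr (_ * _).
by rewrite exprB// unitfE pnatr_eq0.
Qed.

Lemma cvg_step_poly_low (t : R) : 0 <= t <= 2^-1 -> step_poly k t @[k --> \oo] --> (1 : R).
Proof.
move=> /andP[t0 t2].
have t01 : 0 <= t <= 1 by rewrite t0; lra.
apply: (@squeeze_cvgr _ _ _ _ (fun k => 1 - 2^-1 ^+ k) (fun=> 1)).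
- apply: nearW => k; have /andP[_ ->] := step_poly_itv k t01; rewrite andbT.
  have tk1 : t ^+ (k ^ 2) <= 1 by case/andP: t01 => *; rewrite exprn_ile1.
  have tk2 : -1 <= - t ^+ (k ^ 2) by rewrite lerN2.
  apply: le_trans (bernoulli_ge (2 ^ (k ^ 2 - k)) tk2).
  rewrite mulrN step_poly_exponent.
  have e0 : 0 <= (2 * t) ^+ k by rewrite exprn_ge0 ?mulr_ge0.
  have e1 : (2 * t) ^+ k <= 1 by rewrite exprn_ile1 ?mulr_ge0//; lra.
  by rewrite lerB// lerXn2r ?nnegrE//; lra.
- rewrite -[X in _ --> X]subr0; apply: cvgB; first exact: cvg_cst.
  by apply: cvg_expr; rewrite ger0_norm; lra.
- exact: cvg_cst.
Qed.

(** Multiplying [(1 - a) ^ N] by [(1 + a) ^ N], at least [1 + N * a], gives at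
    most [1]; here [N * a] eventually exceeds [2 ^ k]. *)
Lemma cvg_step_poly_high (t : R) : 2^-1 < t <= 1 -> step_poly k t @[k --> \oo] --> (0 : R).
Proof.
move=> /andP[t2 t1].
have t01 : 0 <= t <= 1 by rewrite t1; lra.
apply: (@squeeze_cvgr _ _ _ _ (fun=> 0) (fun k => 2^-1 ^+ k)); last 2 first.
- exact: cvg_cst.
- by apply: cvg_expr; rewrite ger0_norm; lra.
have d0 : 0 < 2 * t - 1 by lra.
near=> k; have /andP[-> _] /= := step_poly_itv k t01.
have k4 : 4 <= (2 * t) ^+ k.
  have d1 : -1 <= 2 * t - 1 by lra.
  have := bernoulli_ge k d1; rewrite addrCA subrr addr0.
  apply: le_trans.
  have : 3 / (2 * t - 1) <= k%:R.
    by near: k; exact: nbhs_infty_ger.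
  by rewrite ler_pdivrMr//; lra.
have hk : 2 ^+ k <= ((2 * t) ^+ k / 2) ^+ k.
  by apply: lerXn2r; rewrite ?nnegrE; lra.
have ta : 0 <= t ^+ (k ^ 2) <= 1.
  by case/andP: t01 => t0 _; rewrite exprn_ge0//= exprn_ile1.
have h2 : 1 + 2 ^+ k <= (1 + t ^+ (k ^ 2)) ^+ (2 ^ (k ^ 2 - k)).
  have tk1 : -1 <= t ^+ (k ^ 2) by case/andP: ta; lra.
  apply: le_trans (bernoulli_ge (2 ^ (k ^ 2 - k)) tk1).
  by rewrite step_poly_exponent lerD2l.
have h3 : step_poly k t * (1 + t ^+ (k ^ 2)) ^+ (2 ^ (k ^ 2 - k)) <= 1.
  rewrite /step_poly -exprMn -subr_sqr expr1n exprn_ile1//.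
    by rewrite subr_ge0 exprn_ile1; case/andP: ta.
  by rewrite gerBl sqr_ge0.
have s0 : 0 <= step_poly k t by case/andP: (step_poly_itv k t01).
have p0 : 0 < 2 ^+ k :> R by rewrite exprn_gt0.
rewrite exprVn -[leRHS]mul1r ler_pdivlMr//; apply: le_trans h3.
by rewrite ler_wpM2l//; lra.
Unshelve. all: by end_near. Qed.

Variables (M : (T -> R) -> Prop) (hM : bounded_algebra M).

Lemma bounded_algebraX f k : M f -> M (fun x => f x ^+ k).
Proof.
move=> Mf; elim: k => [|k IHk].
  by under eq_fun do rewrite expr0; exact: bounded_algebra_cst.
by under eq_fun do rewrite exprS; exact: bounded_algebraM.
Qed.

Lemma bounded_algebraN1 f : M f -> M (fun x => 1 - f x).
Proof.
move=> Mf; under eq_fun do rewrite -mulN1r.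
apply: (bounded_algebraD hM); first exact: bounded_algebra_cst.
by apply: (bounded_algebraM hM) => //; exact: bounded_algebra_cst.
Qed.

(** The step polynomials in [f] converge to the indicator at every point. *)
Lemma bounded_algebra_half f : M f -> (forall x, 0 <= f x <= 1) ->
  M (\1_[set x | f x <= 2^-1]).
Proof.
move=> Mf f01.
apply: (@bounded_algebra_lim _ hM (fun k x => step_poly k (f x)) _ 1).
- by move=> k; apply/bounded_algebraX/bounded_algebraN1/bounded_algebraX.
- by move=> k x; have /andP[? ?] := step_poly_itv k (f01 x); rewrite ger0_norm.
- move=> x; rewrite indicE; have /andP[f0 f1] := f01 x; have [fx|fx] := leP (f x) 2^-1.
    by rewrite mem_set//; apply: cvg_step_poly_low; rewrite f0.
  by rewrite memNset//=; [apply: cvg_step_poly_high; rewrite fx|apply/negP; rewrite -ltNge].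
Qed.

Lemma bounded_algebra_level f c : M f -> (forall x, `|f x| <= 1) -> `|c| <= 1 ->
  M (\1_[set x | f x <= c]).
Proof.
move=> Mf f1 c1.
rewrite (_ : mkset _ = [set x | (2^-1 - c / 4) + 4^-1 * f x <= 2^-1]).
  apply: bounded_algebra_half => [|x].
    apply: (bounded_algebraD hM); first exact: bounded_algebra_cst.
    by apply: (bounded_algebraM hM) => //; exact: bounded_algebra_cst.
  by have := f1 x; move: c1; rewrite !ler_norml => /andP[? ?] /andP[? ?]; lra.
by apply/seteqP; split => x /=; lra.
Qed.

(** A countable union is handled through the products of the complementary
    indicators, whose partial products are eventually constant at each point. *)
Lemma bounded_algebra_sigma : sigma_algebra setT [set A | M (\1_A)].
Proof.
split => /=.
- by rewrite indic0; exact: (bounded_algebra_cst hM 0).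
- move=> A /= MA; rewrite setTD (_ : \1__ = fun x => 1 - \1_A x :> R).
    exact: bounded_algebraN1.
  apply/funext => x; rewrite !indicE; have [Ax|Ax] := pselect (A x).
    by rewrite memNset ?mem_set ?subrr//= => /(_ Ax).
  by rewrite mem_set// memNset// subr0.
- move=> A /= MA.
  pose f_ k x : R := 1 - \prod_(j < k) (1 - \1_(A j) x).
  have p01 k x : 0 <= \prod_(j < k) (1 - \1_(A j) x : R) <= 1.
    apply/andP; split.
      by apply: prodr_ge0 => j _; rewrite indicE; case: (_ \in _); rewrite ?subrr ?subr0.
    apply: prodr_ile1 => j _; rewrite indicE.
    by case: (_ \in _); rewrite ?subrr ?subr0 lexx ler01.
  apply: (@bounded_algebra_lim _ hM f_ _ 1).
  + move=> k; apply: bounded_algebraN1; elim: k => [|k IHk].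
      by under eq_fun do rewrite big_ord0; exact: bounded_algebra_cst.
    under eq_fun do rewrite big_ord_recr.
    by apply: (bounded_algebraM hM) => //; exact/bounded_algebraN1/MA.
  + by move=> k x; have /andP[? ?] := p01 k x; rewrite /f_ ger0_norm; lra.
  + move=> x; rewrite indicE; have [[j _ Aj]|Ax] := pselect ((\bigcup_k A k) x).
      rewrite mem_set; last by exists j.
      apply: cvg_near_cst; exists j.+1 => // k /= jk.
      rewrite /f_ (bigD1 (Ordinal jk))//= indicE mem_set// subrr mul0r.
      by rewrite subr0.
    rewrite memNset//; apply: cvg_near_cst; apply: nearW => k.
    rewrite /f_ big1 ?subrr// => j _; rewrite indicE memNset ?subr0// => Aj.
    by apply: Ax; exists j.
Qed.

End bounded_algebra.

(** * Uniqueness of Fourier coefficients of integrable functions *)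

Section fourier_uniqueness.
Variables (R : realType) (n : nat) (om r : R).
Hypotheses (r0 : 0 < r) (omr : `|om| * r = pi).

Let mu := lebesgue_rV R n.
Let D := [set x : 'rV[R]_n | forall i, `|x ord0 i| <= r].
Let mD : measurable D. Proof. exact: measurable_cube. Qed.

Definition bounded_mfun (phi : 'rV[R]_n -> R) :=
  measurable_fun [set: 'rV[R]_n] phi /\ exists B, forall x, `|phi x| <= B.

Lemma bounded_mfun_cst c : bounded_mfun (fun=> c).
Proof. by split=> //; exists `|c|. Qed.

Lemma bounded_mfunD f g : bounded_mfun f -> bounded_mfun g ->
  bounded_mfun (fun x => f x + g x).
Proof.
move=> [mf [B fB]] [mg [C gC]]; split; first exact: measurable_funD.
by exists (B + C) => x; apply: le_trans (ler_normD _ _) (lerD _ _).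
Qed.

Lemma bounded_mfunM f g : bounded_mfun f -> bounded_mfun g ->
  bounded_mfun (fun x => f x * g x).
Proof.
move=> [mf [B fB]] [mg [C gC]]; split; first exact: measurable_funM.
by exists (B * C) => x; rewrite normrM ler_pM.
Qed.

Lemma bounded_mfun_cos m t0 : bounded_mfun (fun x => cos (phase om m x + t0)).
Proof.
split; first exact: measurable_cos_phase.
by exists 1 => x; exact: cos_max.
Qed.

Lemma bounded_mfun_cos0 m : bounded_mfun (fun x => cos (phase om m x)).
Proof. by under eq_fun do rewrite -[phase _ _ _]addr0; exact: bounded_mfun_cos. Qed.

Lemma bounded_mfun_sin m : bounded_mfun (fun x => sin (phase om m x)).
Proof.
under eq_fun do rewrite -[phase _ _ _](subrK (pi / 2)) sinDpihalf.
exact: bounded_mfun_cos.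
Qed.

Variable u : 'rV[R]_n -> R.
Hypothesis iu : mu.-integrable D (fun x => (u x)%:E).

Lemma integrable_mul_bounded phi : bounded_mfun phi ->
  mu.-integrable D (fun x => (u x * phi x)%:E).
Proof.
move=> [mphi [B phiB]].
have B0 : 0 <= B by exact: le_trans (phiB 0).
apply: (le_integrable mD _ _ (integrableZl mD B iu)).
  apply/measurable_EFinP; apply: measurable_funM; last exact: measurable_funTS.
  by apply/measurable_EFinP; exact: measurable_int iu.
move=> x _; rewrite -EFinM !abse_EFin lee_fin !normrM mulrC (ger0_norm B0).
by rewrite ler_wpM2r.
Qed.

Definition integral_against phi : \bar R := (\int[mu]_(x in D) (u x * phi x)%:E)%E.

Lemma integral_againstD f g : bounded_mfun f -> bounded_mfun g ->
  integral_against (fun x => f x + g x) =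
  (integral_against f + integral_against g)%E.
Proof.
move=> bf bg; rewrite /integral_against.
rewrite -integralD_EFin//; try exact: integrable_mul_bounded.
by apply: eq_integral => x _ /=; rewrite mulrDr.
Qed.

Lemma integral_againstZ c f : bounded_mfun f ->
  integral_against (fun x => c * f x) = (c%:E * integral_against f)%E.
Proof.
move=> bf; rewrite /integral_against -integralZl//; last exact: integrable_mul_bounded.
by apply: eq_integral => x _; rewrite -EFinM mulrCA.
Qed.

Lemma integral_against_cvg (f_ : nat -> 'rV[R]_n -> R) f B :
  (forall k, bounded_mfun (f_ k)) -> bounded_mfun f ->
  (forall k x, `|f_ k x| <= B) -> (forall x, f_ ^~ x @ \oo --> f x) ->
  integral_against (f_ k) @[k --> \oo] --> integral_against f.
Proof.
move=> bf_ bf fB f_f.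
have B0 : 0 <= B by exact: le_trans (fB 0 0).
have [] := @dominated_convergence _ _ _ mu D mD
  (fun k x => (u x * f_ k x)%:E) (fun x => (u x * f x)%:E)
  (fun x => (B%:E * `|u x|%:E)%E).
- by move=> k; exact: measurable_int (integrable_mul_bounded (bf_ k)).
- exact: measurable_int (integrable_mul_bounded bf).
- apply: aeW => x _; apply: cvg_EFin; first exact: nearW.
  by apply: cvgM => //; exact: cvg_cst.
- by apply: integrableZl => //; exact: integrable_abse iu.
- apply: aeW => x k _; rewrite abse_EFin -EFinM lee_fin normrM mulrC.
  by rewrite ler_wpM2r.
- by [].
Qed.

Definition fourier_null psi := forall m t0,
  integral_against (fun x => psi x * cos (phase om m x + t0)) = 0%E.

(** Multipliers of the space of bounded functions whose product with [u] has
    zero Fourier coefficients. Unlike that space, they form an algebra. *)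
Definition multiplier phi := bounded_mfun phi /\
  forall psi, bounded_mfun psi -> fourier_null psi ->
    fourier_null (fun x => psi x * phi x).

Lemma multiplier_algebra : bounded_algebra multiplier.
Proof.
split.
- move=> c; split=> [|psi bpsi psi0 m t0]; first exact: bounded_mfun_cst.
  have := psi0 m t0; rewrite (_ : (fun x => psi x * c * _) =
    fun x => c * (psi x * cos (phase om m x + t0))); last first.
    by apply/funext => x; ring.
  rewrite integral_againstZ; first by move=> ->; rewrite mule0.
  by apply: bounded_mfunM => //; exact: bounded_mfun_cos.
- move=> f g [bf nf] [bg ng]; split=> [|psi bpsi psi0 m t0].
    exact: bounded_mfunD.
  rewrite (_ : (fun x => psi x * _ * _) =
    fun x => psi x * f x * cos (phase om m x + t0) +
             psi x * g x * cos (phase om m x + t0)); last first.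
    by apply/funext => x; ring.
  rewrite integral_againstD; try by apply: bounded_mfunM;
    [exact: bounded_mfunM|exact: bounded_mfun_cos].
  by rewrite nf// ng// adde0.
- move=> f g [bf nf] [bg ng]; split=> [|psi bpsi psi0].
    exact: bounded_mfunM.
  under eq_fun do rewrite mulrA.
  apply: ng; last exact: nf.
  exact: bounded_mfunM.
- move=> f_ f B mf_ fB f_f.
  have bf : bounded_mfun f.
    split.
      apply: (measurable_fun_cvg (h := f_)) => [k|x _]; last exact: f_f.
      by have [[]] := mf_ k.
    exists B => x; apply: (ler_cvg_to (cvg_norm (f_f x)) (cvg_cst B)).
    exact: nearW.
  split=> // psi bpsi psi0 m t0.
  have [C psiC] := bpsi.2.
  have H := @integral_against_cvg
    (fun k x => psi x * f_ k x * cos (phase om m x + t0))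
    (fun x => psi x * f x * cos (phase om m x + t0)) (C * B * 1).
  have : (fun=> 0%E) @ \oo --> integral_against
      (fun x => psi x * f x * cos (phase om m x + t0)).
    rewrite (_ : (fun=> 0%E) = fun k => integral_against
      (fun x => psi x * f_ k x * cos (phase om m x + t0))); last first.
      by apply/funext => k; rewrite (mf_ k).2.
    apply: H.
    + move=> k; apply: bounded_mfunM; last exact: bounded_mfun_cos.
      by apply: bounded_mfunM => //; exact: (mf_ k).1.
    + by apply: bounded_mfunM; [exact: bounded_mfunM|exact: bounded_mfun_cos].
    + by move=> k x; rewrite !normrM !ler_pM ?mulr_ge0 ?cos_max.
    + move=> x; apply: cvgM; last exact: cvg_cst.
      by apply: cvgM; [exact: cvg_cst|exact: f_f].
  by move/cvg_lim => <-//; rewrite lim_cst.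
Qed.

(** The product of two cosines is half the sum of two cosines. *)
Lemma multiplier_cos m t0 : multiplier (fun x => cos (phase om m x + t0)).
Proof.
split=> [|psi bpsi psi0 m' t0']; first exact: bounded_mfun_cos.
rewrite (_ : (fun x => _) = fun x =>
  2^-1 * (psi x * cos (phase om (m + m') x + (t0 + t0'))) +
  2^-1 * (psi x * cos (phase om (m - m') x + (t0 - t0')))); last first.
  apply/funext => x; rewrite !phase_addm phase_oppm.
  have -> : phase om m x + phase om m' x + (t0 + t0') =
    (phase om m x + t0) + (phase om m' x + t0') by ring.
  have -> : phase om m x - phase om m' x + (t0 - t0') =
    (phase om m x + t0) - (phase om m' x + t0') by ring.
  move: (phase om m x + t0) (phase om m' x + t0') => a b.
  by rewrite cosD cosB; field.
have bc k s : bounded_mfun (fun x => psi x * cos (phase om k x + s)).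
  by apply: bounded_mfunM => //; exact: bounded_mfun_cos.
rewrite integral_againstD ?integral_againstZ// ?psi0 ?mule0 ?adde0//;
  by apply: bounded_mfunM => //; exact: bounded_mfun_cst.
Qed.

Definition multiplier_set (A : set 'rV[R]_n) := multiplier (\1_A).

Lemma multiplier_set_sigma : sigma_algebra setT multiplier_set.
Proof. exact: bounded_algebra_sigma multiplier_algebra. Qed.

Lemma multiplier_setC A : multiplier_set A -> multiplier_set (~` A).
Proof.
by have [_ hC _] := multiplier_set_sigma; move=> /hC; rewrite setTD.
Qed.

(** The integrals against [u] are taken over the cube, so they do not see a change
    of the indicator outside the cube or on a null set. *)
Lemma multiplier_set_ae (A B N : set 'rV[R]_n) :
  measurable B -> measurable N -> mu N = 0%E ->
  (forall x, D x -> ~ N x -> A x <-> B x) ->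
  multiplier_set A -> multiplier_set B.
Proof.
move=> mB mN N0 AB [bA nA].
have bB : bounded_mfun (\1_B).
  split; first exact: measurable_indic.
  by exists 1 => x; rewrite indicE; case: (_ \in _); rewrite ?normr1 ?normr0.
split=> // psi bpsi psi0 m t0; rewrite -[RHS](nA psi bpsi psi0 m t0).
apply: ae_eq_integral => //.
- apply: measurable_int (integrable_mul_bounded _).
  by apply: bounded_mfunM; [exact: bounded_mfunM|exact: bounded_mfun_cos].
- apply: measurable_int (integrable_mul_bounded _).
  by apply: bounded_mfunM; [exact: bounded_mfunM|exact: bounded_mfun_cos].
exists N; split=> // x /= h; apply: contrapT => Nx; apply: h => Dx.
have {}AB := AB x Dx Nx; rewrite !indicE; congr (_ * (_ * (_%:R) * _))%:E.
have [Bx|Bx] := pselect (B x); first by rewrite !mem_set//; exact/AB.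
by rewrite !memNset//; move/AB.
Qed.

(** The cosine decreases with [|t|] up to [|t| = pi]. For [t < - pi], its value is
    that at [t + 2 * pi], a point between [a] and [pi]. *)
Lemma cos_gt_itv (a t : R) : 0 <= a <= pi -> - (pi *+ 2 - a) <= t <= a ->
  (cos a < cos t) = (- a < t < a).
Proof.
move=> /andP[a0 api] /andP[t1 t2].
have pi0 := pi_gt0 R.
have [tpi|tpi] := leP (- pi) t.
  rewrite -(cos_norm t) -ltr_norml ltr_cos// in_itv/= ?a0// normr_ge0/=.
  by rewrite ler_norml tpi/=; lra.
have -> : (- a < t < a) = false by apply/negP => /andP[? ?]; lra.
apply/negbTE; rewrite -leNgt -(cosD2pi t) le_eqVlt.
have [->|ne] := eqVneq (t + pi *+ 2) a; first by rewrite eqxx.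
rewrite ltr_cos ?in_itv/= ?a0//; last by rewrite mulr2n in t1 *; lra.
by rewrite orbC lt_neqAle eq_sym ne/=; rewrite mulr2n in t1 *; lra.
Qed.

(** The points of the cube with [a < x_i < r] are those where the cosine of
    period [2 * r] centred at the midpoint [c] exceeds its value at distance [w],
    the half-length; the face [x_i = r] is null. *)
Lemma multiplier_ray i (a : R) : multiplier_set [set x | a < x ord0 i].
Proof.
have mray : measurable [set x : 'rV[R]_n | a < x ord0 i].
  have mi := @measurable_rV_coor R n i measurableT _
    (measurable_itv (`]a, +oo[ : interval R)).
  rewrite setTI in mi.
  suff <- : @rV_coor R n i @^-1` `]a, +oo[%classic = [set x | a < x ord0 i] by [].
  by apply/seteqP; split => x /=; rewrite in_itv/= andbT.
have [sg0 sgC _] := multiplier_set_sigma.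
have [ra|ar] := leP r a.
  apply: (@multiplier_set_ae set0 _ set0) => // x Dx _; split=> //= ax.
  by have := le_lt_trans ra ax; have := Dx i; rewrite ler_norml => /andP[_]; lra.
have [ar'|ra] := ltP a (- r).
  apply: (@multiplier_set_ae setT _ set0) => //; last first.
    by have := multiplier_setC sg0; rewrite setC0.
  move=> x Dx _; split=> //= _.
  by have := Dx i; rewrite ler_norml => /andP[? _]; lra.
pose A j : set (measurableTypeR R) :=
  if j == i then [set r] else `[- r, r]%classic.
have mA j : measurable (A j) by rewrite /A; case: ifP.
pose c := (a + r) / 2; pose w := (r - a) / 2.
apply: (@multiplier_set_ae
  (~` [set x | cos (phase om (delta_mx ord0 i) x + - (om * c)) <= cos (`|om| * w)])
  _ [set x | forall j, A j (x ord0 j)]) => //.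
- exact: measurable_rV_box.
- rewrite /mu lebesgue_rV_box// (bigD1 i)//= /A eqxx.
  by rewrite (lebesgue_measure_set1 r) mul0e.
- move=> x Dx Nx; rewrite /setC /=.
  have xr : x ord0 i != r.
    apply/eqP => xr; apply: Nx => j; rewrite /A; case: eqP => [->|_] //=.
    by have := Dx j; rewrite in_itv/= ler_norml.
  have -> : phase om (delta_mx ord0 i) x = om * x ord0 i.
    rewrite /phase /dotr (bigD1 i)//= big1 => [|j ji].
      by rewrite !mxE !eqxx mul1r addr0.
    by rewrite !mxE (negbTE ji) andbF mul0r.
  have -> : cos (om * x ord0 i - om * c) = cos (`|om| * (x ord0 i - c)).
    by rewrite -mulrBr -cos_norm -[in RHS]cos_norm !normrM normr_id.
  have om0 : 0 < `|om|.
    by rewrite -(pmulr_lgt0 _ r0) omr pi_gt0.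
  have /andP[x1 x2] : - r <= x ord0 i <= r by rewrite -ler_norml.
  rewrite /= (rwP negP) -ltNge cos_gt_itv.
  + rewrite -mulrN !ltr_pM2l// /c /w.
    split=> [/andP[h1 h2]|ax]; first by lra.
    by rewrite lt_neqAle in xr *; apply/andP; split; lra.
  + rewrite mulr_ge0 /w; [|by []|lra]; rewrite -omr ler_pM2l//; lra.
  + rewrite -omr -mulrnAr -mulrBr -mulrN !ler_pM2l// /c /w mulr2n.
    by apply/andP; split; lra.
- apply: multiplier_setC.
  apply: (bounded_algebra_level multiplier_algebra).
  + exact: multiplier_cos.
  + by move=> x; exact: cos_max.
  + exact: cos_max.
Qed.

(** Half-open intervals are differences of rays, and their preimages under the
    coordinates generate the sigma-algebra. *)
Lemma multiplier_measurable A : measurable A -> multiplier_set A.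
Proof.
have sg := multiplier_set_sigma; have [sg0 sgC sgU] := sg.
have sgI B C : multiplier_set B -> multiplier_set C -> multiplier_set (B `&` C).
  move=> mB mC; rewrite /multiplier_set indicI.
  exact: (bounded_algebraM multiplier_algebra).
suff coor i B : measurable B -> multiplier_set (@rV_coor R n i @^-1` B).
  suff : measurable `<=` multiplier_set by exact.
  apply: smallest_sub; first exact: sg.
  move=> S; rewrite -bigcup_seq => -[i _ [B mB <-]].
  by rewrite setTI; exact: coor.
suff : measurable `<=` [set B | multiplier_set (@rV_coor R n i @^-1` B)] by exact.
apply: smallest_sub.
  split; first by rewrite /= preimage_set0.
  - by move=> S mS; rewrite /= setTD preimage_setC; exact: multiplier_setC.
  - by move=> F mF; rewrite /= preimage_bigcup; exact: sgU.
move=> _ [[a b] _ <-] /=.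
suff -> : @rV_coor R n i @^-1` `]a, b] =
    [set x | a < x ord0 i] `&` ~` [set x | b < x ord0 i].
  by apply: sgI; [|apply: multiplier_setC]; exact: multiplier_ray.
apply/seteqP; split => x /=; rewrite /rV_coor in_itv/=.
  by move=> /andP[-> xb]; split=> //; apply/negP; rewrite -leNgt.
by move=> [-> /negP]; rewrite -leNgt.
Qed.

(** The constant function [1] belongs to the space on which multipliers act, so
    the integral of [u] over every measurable part of the cube is zero. *)
Lemma fourier_uniqueness :
  (forall m t0, \int[mu]_(x in D) (u x * cos (phase om m x + t0))%:E = 0)%E ->
  ae_eq mu D (fun x => (u x)%:E) (cst 0%E).
Proof.
move=> u0; apply: (integral_ae_eq _ iu) => // E ED mE.
rewrite integral0.
have [_ /(_ (fun=> 1) (bounded_mfun_cst 1))] := multiplier_measurable mE.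
have n1 : fourier_null (fun=> 1).
  move=> m t0; rewrite -[RHS](u0 m t0).
  by apply: eq_integral => x _; rewrite mul1r.
move=> /(_ n1 0 0) <-.
rewrite -[in LHS](setIidr ED) integral_mkcondr; apply: eq_integral => x _.
have -> : phase om 0 x = 0.
  by rewrite /phase /dotr big1 ?mulr0// => j _; rewrite !mxE mul0r.
rewrite addr0 cos0 mulr1 mul1r /patch indicE.
by case: (x \in E); rewrite ?mulr1 ?mulr0.
Qed.

End fourier_uniqueness.

(** * Fourier coefficients of a trigonometric series *)

Section fourier_coefficients.
Variables (R : realType) (n : nat) (om r : R).
Hypotheses (r0 : 0 < r) (omr : `|om| * r = pi).
Implicit Types (c : 'rV[int]_n -> R[i]) (m : 'rV[int]_n).

Let mu := lebesgue_rV R n.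
Let D := [set x : 'rV[R]_n | forall i, `|x ord0 i| <= r].
Let mD : measurable D. Proof. exact: measurable_cube. Qed.

Lemma sin_half_period (k : int) : sin (r * (om * k%:~R)) = 0.
Proof.
rewrite mulrA [r * om]mulrC; case: (leP 0 om) => om0.
  by rewrite -(ger0_norm om0) omr mulrC sin_int_pi.
have -> : om = - `|om| by rewrite ltr0_norm ?opprK.
by rewrite !mulNr omr sinN mulrC sin_int_pi oppr0.
Qed.

Lemma om_neq0 : om != 0.
Proof. by apply/eqP => om0; have := pi_gt0 R; rewrite -omr om0 normr0 mul0r ltxx. Qed.

Lemma rexp_periodic (z : R[i]) t (k : int) :
  rexp z (t + r *+ 2 * (om * k%:~R)) = rexp z t.
Proof.
have s0 : sin (r *+ 2 * (om * k%:~R)) = 0.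
  by rewrite mulr2n mulrDl sinD sin_half_period mulr0 mul0r addr0.
have c1 : cos (r *+ 2 * (om * k%:~R)) = 1.
  have := cos2Dsin2 (r * (om * k%:~R)).
  by rewrite mulr2n mulrDl cosD sin_half_period mulr0 subr0 expr0n addr0 expr2.
by rewrite /rexp cosD sinD s0 c1; ring.
Qed.

Lemma fseries_periodic c x i :
  fseries om c (x + (r *+ 2) *: delta_mx ord0 i) = fseries om c x.
Proof.
rewrite /fseries; congr (limn (series (lattice_seq _))); apply/funext => m.
by rewrite /fterm addrC phaseD phase_scale_delta rexp_periodic.
Qed.

Lemma integrable_bounded_cube phi : bounded_mfun phi ->
  mu.-integrable D (fun x => (phi x)%:E).
Proof.
move=> [mphi [B phiB]]; apply: measurable_bounded_integrable => //.
- by rewrite [mu D]lebesgue_rV_cube ?ltW// ltry.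
- exact: measurable_funTS.
- exists B; split=> [|y By x _]; first exact: num_real.
  exact: le_trans (phiB x) (ltW By).
Qed.

Let integrable1 : mu.-integrable D (fun x => (1 : R)%:E).
Proof. exact: integrable_bounded_cube (bounded_mfun_cst n 1). Qed.

Lemma integral_cube_cos m t0 :
  (\int[mu]_(x in D) (cos (phase om m x + t0))%:E =
   ((r *+ 2) ^+ n * ((m == 0)%:R * cos t0))%:E)%E.
Proof.
have icos := integrable_bounded_cube (bounded_mfun_cos om m t0).
have := integral_cube_cos1 m t0 r0 sin_half_period om_neq0.
under eq_integral do rewrite EFinD.
rewrite integralD_EFin// integral_cst// mul1e lebesgue_rV_cube ?ltW//.
rewrite mulrDr mulr1 -(fineK (integrable_fin_num mD icos)) -EFinD => -[].
by move/addrI => ->.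
Qed.

Lemma rexp_cosE (z : R[i]) t :
  rexp z t = complex.Re z * cos (t + 0) + complex.Im z * cos (t + pi / 2).
Proof. by rewrite /rexp addr0 cosDpihalf mulrN. Qed.

Lemma bounded_mfun_rexp (z : R[i]) m : bounded_mfun (fun x => rexp z (phase om m x)).
Proof.
under eq_fun do rewrite rexp_cosE.
by apply: bounded_mfunD; apply: bounded_mfunM;
  [exact: bounded_mfun_cst|exact: bounded_mfun_cos|
   exact: bounded_mfun_cst|exact: bounded_mfun_cos].
Qed.

Lemma integral_cube_rexp (z : R[i]) m :
  (\int[mu]_(x in D) (rexp z (phase om m x))%:E =
   ((r *+ 2) ^+ n * ((m == 0)%:R * complex.Re z))%:E)%E.
Proof.
have icos t := integrable_bounded_cube (bounded_mfun_cos om m t).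
under eq_integral do rewrite rexp_cosE EFinD !EFinM.
rewrite integralD; last 3 first.
- exact: mD.
- by apply: integrableZl => //; exact: icos.
- by apply: integrableZl => //; exact: icos.
rewrite !integralZl//; try exact: icos.
rewrite !integral_cube_cos cos0 cos_pihalf !mulr0 mule0 adde0 -EFinM mulr1.
by congr (_%:E); ring.
Qed.

Lemma bounded_mfun_sum (I : Type) (s : seq I) (F : I -> 'rV[R]_n -> R) :
  (forall i, bounded_mfun (F i)) -> bounded_mfun (fun x => \sum_(i <- s) F i x).
Proof.
move=> bF; elim: s => [|i s IHs].
  by under eq_fun do rewrite big_nil; exact: bounded_mfun_cst.
by under eq_fun do rewrite big_cons; exact: bounded_mfunD.
Qed.

Lemma norm_series_lattice_le (F B : 'rV[int]_n -> R) N :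
  (forall m, `|F m| <= B m) -> lattice_summable B ->
  `|series (lattice_seq F) N| <= limn (series (lattice_seq B)).
Proof.
move=> FB sB; apply: (@le_trans _ _ (series (lattice_seq B) N)).
  apply: le_trans (ler_norm_sum _ _ _) _.
  by apply: ler_sum => k _; exact: lattice_seq_le.
apply: nondecreasing_cvgn_le => //; apply: nondecreasing_series => k _ _.
by rewrite /lattice_seq; case: pickle_inv => //= m; exact: le_trans (FB m).
Qed.

Lemma bounded_mfun_fseries c : summable_coef c -> bounded_mfun (fseries om c).
Proof.
move=> sc.
have bN N : bounded_mfun (fun x => series (lattice_seq (fterm om c x)) N).
  under eq_fun do rewrite series_lattice_seq.
  by apply: bounded_mfun_sum => m; exact: bounded_mfun_rexp.
split.
  apply: (measurable_fun_cvg
    (h := fun N x => series (lattice_seq (fterm om c x)) N)) => [N|x _].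
    by have [] := bN N.
  exact: is_cvg_fseries.
exists (limn (series (lattice_seq (fun m => ell1 (c m))))) => x.
apply: norm_lim_series_le => // k; apply: lattice_seq_le => m.
exact: norm_rexp_le.
Qed.

(** Termwise integration: the real part of [L ^ n] times the [m]-th Fourier
    coefficient of the sum of the series. *)
Lemma integral_cfseries_char c m : summable_coef c ->
  (\int[mu]_(x in D) (fseries om c x * cos (phase om m x) +
      fseries om (rotc c) x * sin (phase om m x))%:E =
   ((r *+ 2) ^+ n * complex.Re (c m))%:E)%E.
Proof.
move=> sc; pose F m' x := rexp (c m') (phase om (m' - m) x).
have FE x m' : F m' x = cos (phase om m x) * fterm om c x m' +
    sin (phase om m x) * fterm om (rotc c) x m'.
  rewrite /F /fterm /rexp.
  rewrite phase_addm phase_oppm.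
  by rewrite cosB sinB /=; ring.
have sumE x : fseries om c x * cos (phase om m x) +
    fseries om (rotc c) x * sin (phase om m x) =
    limn (series (lattice_seq (F ^~ x))).
  have c1 := @is_cvg_fseries _ _ om _ x sc.
  have c2 := @is_cvg_fseries _ _ om _ x (summable_rotc sc).
  have -> : lattice_seq (F ^~ x) =
    cos (phase om m x) *: lattice_seq (fterm om c x) +
    sin (phase om m x) *: lattice_seq (fterm om (rotc c) x).
    rewrite -!lattice_seqZ; apply/funext => k.
    rewrite -[RHS]/(lattice_seq _ k + lattice_seq _ k) /lattice_seq.
    by case: pickle_inv => /= [m'|]; rewrite ?addr0 ?FE.
  rewrite lim_seriesD; [|exact: is_cvg_seriesZ|exact: is_cvg_seriesZ].
  by rewrite (lim_seriesZ _ c1) (lim_seriesZ _ c2) mulrC [X in _ + X]mulrC.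
transitivity (\int[mu]_(x in D) (limn (series (lattice_seq (F ^~ x))))%:E)%E.
  by apply: eq_integral => x _; rewrite sumE.
have cF x : cvgn (series (lattice_seq (F ^~ x))).
  apply: is_cvg_series_dominated sc => k; apply: lattice_seq_le => m'.
  exact: norm_rexp_le.
have bN N : bounded_mfun (fun x => series (lattice_seq (F ^~ x)) N).
  under eq_fun do rewrite series_lattice_seq.
  by apply: bounded_mfun_sum => m'; exact: bounded_mfun_rexp.
have bl : bounded_mfun (fun x => limn (series (lattice_seq (F ^~ x)))).
  under eq_fun do rewrite -sumE.
  apply: bounded_mfunD; apply: bounded_mfunM.
  - exact: bounded_mfun_fseries.
  - exact: bounded_mfun_cos0.
  - exact/bounded_mfun_fseries/summable_rotc.
  - exact: bounded_mfun_sin.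
have := integral_against_cvg integrable1 bN bl
  (fun N x => norm_series_lattice_le N (fun m' => norm_rexp_le (c m') _) sc) cF.
rewrite /integral_against; under [in X in _ -> X]eq_integral do rewrite -[limn _]mul1r.
set J := (X in _ --> X) => hJ; transitivity J => //.
suff hc : (fun N => (\int[mu]_(x in D) (1 * series (lattice_seq (F ^~ x)) N)%:E)%E)
    @ \oo --> ((r *+ 2) ^+ n * complex.Re (c m))%:E.
  by rewrite -(cvg_lim _ hJ)//; exact: cvg_lim.
(* The only nonzero term is reached after [pickle m] steps. *)
apply: cvg_near_cst; exists (pickle m).+1 => // N /= mN.
under eq_integral do rewrite mul1r series_lattice_seq -sumEFin.
rewrite integral_sum//; last first.
  by move=> m'; exact: integrable_bounded_cube (bounded_mfun_rexp _ _).
under eq_bigr do rewrite integral_cube_rexp.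
rewrite sumEFin; congr (_%:E).
have us : uniq (pmap pickle_inv (iota 0 N) : seq 'rV[int]_n).
  by rewrite (pmap_uniq (@pickle_invK _))// iota_uniq.
rewrite (bigD1_seq m) //=; last first.
  by rewrite mem_pmap -(pickleK_inv m) map_f// mem_iota.
rewrite subrr eqxx mul1r big1 ?addr0// => m' m'm.
by rewrite subr_eq0 (negbTE m'm) mul0r mulr0.
Qed.

End fourier_coefficients.

(** * Reconstruction of an integrable function *)

Section fourier_reconstruction.
Variables (R : realType) (n : nat) (om r : R).
Hypotheses (r0 : 0 < r) (omr : `|om| * r = pi).
Implicit Types (c : 'rV[int]_n -> R[i]) (m : 'rV[int]_n) (u v : 'rV[R]_n -> R).

Let mu := lebesgue_rV R n.
Let D := [set x : 'rV[R]_n | forall i, `|x ord0 i| <= r].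
Let mD : measurable D. Proof. exact: measurable_cube. Qed.

Let integrable_mulb u phi : mu.-integrable D (fun x => (u x)%:E) -> bounded_mfun phi ->
  mu.-integrable D (EFin \o (fun x => u x * phi x)).
Proof. by move=> iu bphi; exact: (@integrable_mul_bounded _ _ r u iu phi bphi). Qed.

(** The real part of [L ^ n] times the [m]-th Fourier coefficient of
    [u + i v]; exchanging [(u, v)] for [(v, - u)] gives the imaginary part. *)
Definition re_char u v m : R :=
  \int[mu]_(x in D) (u x * cos (phase om m x) + v x * sin (phase om m x)).

Lemma re_charE u v m :
  mu.-integrable D (fun x => (u x)%:E) -> mu.-integrable D (fun x => (v x)%:E) ->
  re_char u v m = \int[mu]_(x in D) (u x * cos (phase om m x)) +
                  \int[mu]_(x in D) (v x * sin (phase om m x)).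
Proof.
move=> iu iv; apply: RintegralD => //.
  exact: integrable_mulb iu (bounded_mfun_cos0 om m).
exact: integrable_mulb iv (bounded_mfun_sin om m).
Qed.

(** The coefficients of index [m] and [- m] together determine the integrals of
    the real and imaginary parts against cosines and sines. *)
Lemma re_char_eq0 u v :
  mu.-integrable D (fun x => (u x)%:E) -> mu.-integrable D (fun x => (v x)%:E) ->
  (forall m, re_char u v m = 0) -> (forall m, re_char v (fun x => - u x) m = 0) ->
  ae_eq mu D (fun x => (u x)%:E) (cst 0%E).
Proof.
move=> iu iv uv vu; apply: (fourier_uniqueness r0 omr iu) => m t0.
have iNu : mu.-integrable D (fun x => (- u x)%:E).
  by under eq_fun do rewrite EFinN; exact: integrableN.
have negc (w : 'rV[R]_n -> R) : \int[mu]_(x in D) (w x * cos (phase om (- m) x)) =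
    \int[mu]_(x in D) (w x * cos (phase om m x)).
  by apply: eq_Rintegral => x _; rewrite phase_oppm cosN.
have Rneg f : mu.-integrable D (fun x => (f x)%:E) ->
    \int[mu]_(x in D) (- f x) = - \int[mu]_(x in D) f x.
  move=> fi; under eq_Rintegral do rewrite -mulN1r.
  by rewrite RintegralZl// mulN1r.
have negs (w : 'rV[R]_n -> R) : mu.-integrable D (fun x => (w x)%:E) ->
    \int[mu]_(x in D) (w x * sin (phase om (- m) x)) =
    - \int[mu]_(x in D) (w x * sin (phase om m x)).
  move=> wi; rewrite -Rneg; last exact: integrable_mulb wi (bounded_mfun_sin om m).
  by apply: eq_Rintegral => x _; rewrite phase_oppm sinN mulrN.
have := uv m; have := uv (- m); rewrite !re_charE// negc negs//.
have := vu m; have := vu (- m); rewrite !re_charE// negc negs//.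
set P := \int[mu]_(x in D) (u x * cos _).
have -> : \int[mu]_(x in D) (- u x * sin (phase om m x)) =
    - \int[mu]_(x in D) (u x * sin (phase om m x)).
  rewrite -Rneg; last exact: integrable_mulb iu (bounded_mfun_sin om m).
  by apply: eq_Rintegral => x _; rewrite mulNr.
set Q := \int[mu]_(x in D) (u x * sin _) => h1 h2 h3 h4.
have P0 : P = 0 by lra.
have Q0 : Q = 0 by lra.
have bc := bounded_mfun_cos om m t0.
rewrite -[LHS](fineK (integrable_fin_num mD (integrable_mulb iu bc))).
rewrite -[fine _]/(\int[mu]_(x in D) (u x * cos (phase om m x + t0))).
have -> : \int[mu]_(x in D) (u x * cos (phase om m x + t0)) = P * cos t0 - Q * sin t0.
  rewrite -!RintegralZr//; last 2 first.
  - exact: integrable_mulb iu (bounded_mfun_sin om m).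
  - exact: integrable_mulb iu (bounded_mfun_cos0 om m).
  rewrite -RintegralB//.
  - by apply: eq_Rintegral => x _; rewrite cosD; ring.
  - under eq_fun do rewrite /= -mulrA.
    apply: integrable_mulb iu _; apply: bounded_mfunM;
      [exact: bounded_mfun_cos0|exact: bounded_mfun_cst].
  - under eq_fun do rewrite /= -mulrA.
    apply: integrable_mulb iu _; apply: bounded_mfunM;
      [exact: bounded_mfun_sin|exact: bounded_mfun_cst].
by rewrite P0 Q0 !mul0r subr0.
Qed.

Lemma fseries_rotc2 c x : summable_coef c ->
  fseries om (rotc (rotc c)) x = - fseries om c x.
Proof.
move=> sc; rewrite /fseries (_ : lattice_seq (fterm om (rotc (rotc c)) x) =
  - lattice_seq (fterm om c x)).
  exact: lim_seriesN (is_cvg_fseries sc).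
apply/funext => k; rewrite -[RHS]/(- lattice_seq _ k) /lattice_seq.
case: pickle_inv => [m|] /=; last by rewrite oppr0.
by rewrite /fterm /rexp /=; ring.
Qed.

Lemma re_charB u v u' v' m :
  mu.-integrable D (fun x => (u x)%:E) -> mu.-integrable D (fun x => (v x)%:E) ->
  mu.-integrable D (fun x => (u' x)%:E) -> mu.-integrable D (fun x => (v' x)%:E) ->
  re_char (fun x => u x - u' x) (fun x => v x - v' x) m =
  re_char u v m - re_char u' v' m.
Proof.
move=> iu iv iu' iv'; rewrite /re_char -RintegralB//.
- by apply: eq_Rintegral => x _; ring.
- have := integrableD mD (integrable_mulb iu (bounded_mfun_cos0 om m)) (integrable_mulb iv (bounded_mfun_sin om m)).
  exact.
- have := integrableD mD (integrable_mulb iu' (bounded_mfun_cos0 om m)) (integrable_mulb iv' (bounded_mfun_sin om m)).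
  exact.
Qed.

Lemma integrable_fseries c : summable_coef c ->
  mu.-integrable D (fun x => (fseries om c x)%:E).
Proof.
move=> sc; apply: (@integrable_bounded_cube _ _ r r0).
exact: bounded_mfun_fseries.
Qed.

Lemma re_char_fseries c m : summable_coef c ->
  re_char (fseries om c) (fseries om (rotc c)) m = (r *+ 2) ^+ n * complex.Re (c m).
Proof. by move=> sc; rewrite /re_char /Rintegral (integral_cfseries_char r0 omr). Qed.

Lemma integrable_oppr u : mu.-integrable D (fun x => (u x)%:E) ->
  mu.-integrable D (fun x => (- u x)%:E).
Proof. by move=> iu; under eq_fun do rewrite EFinN; exact: integrableN. Qed.

Lemma integrable_subr u v : mu.-integrable D (fun x => (u x)%:E) ->
  mu.-integrable D (fun x => (v x)%:E) -> mu.-integrable D (fun x => (u x - v x)%:E).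
Proof. by move=> iu iv; under eq_fun do rewrite EFinB; exact: integrableB. Qed.

(** Uniqueness applied to the difference with the sum of the series, which has
    the same coefficients by termwise integration. *)
Lemma ae_eq_fseries u v c : summable_coef c ->
  mu.-integrable D (fun x => (u x)%:E) -> mu.-integrable D (fun x => (v x)%:E) ->
  (forall m, re_char u v m = (r *+ 2) ^+ n * complex.Re (c m)) ->
  (forall m, re_char v (fun x => - u x) m = (r *+ 2) ^+ n * complex.Im (c m)) ->
  {ae mu, forall x, D x -> u x = fseries om c x /\ v x = fseries om (rotc c) x}.
Proof.
move=> sc iu iv uv vu.
have iS := integrable_fseries sc.
have iT := integrable_fseries (summable_rotc sc).
pose u' x := u x - fseries om c x; pose v' x := v x - fseries om (rotc c) x.
have iu' : mu.-integrable D (fun x => (u' x)%:E) by exact: integrable_subr.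
have iv' : mu.-integrable D (fun x => (v' x)%:E) by exact: integrable_subr.
have uv0 m : re_char u' v' m = 0 by rewrite re_charB// uv re_char_fseries// subrr.
have vu0 m : re_char v' (fun x => - u' x) m = 0.
  have -> : (fun x => - u' x) = (fun x => - u x - fseries om (rotc (rotc c)) x).
    by apply/funext => x; rewrite fseries_rotc2// /u'; ring.
  have sr := summable_rotc sc.
  rewrite re_charB ?vu ?re_char_fseries//; last 2 first.
  - exact: integrable_oppr.
  - exact/integrable_fseries/summable_rotc.
  by rewrite -mulrBr /= mulN1r opprK subrr mulr0.
have nuv0 m : re_char (fun x => - u' x) (fun x => - v' x) m = 0.
  rewrite -[RHS]oppr0 -(uv0 m) /re_char.
  transitivity (\int[mu]_(x in D)
    (-1 * (u' x * cos (phase om m x) + v' x * sin (phase om m x)))).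
    by apply: eq_Rintegral => x _; ring.
  rewrite RintegralZl ?mulN1r//.
  have := integrableD mD (integrable_mulb iu' (bounded_mfun_cos0 om m))
    (integrable_mulb iv' (bounded_mfun_sin om m)).
  exact.
have iNu' := integrable_oppr iu'.
have := re_char_eq0 iu' iv' uv0 vu0.
have := re_char_eq0 iv' iNu' vu0 nuv0.
apply: filterS2 => x hv hu Dx.
have [] := hu Dx; have [] := hv Dx.
by move=> /eqP + /eqP; rewrite !subr_eq0 => /eqP -> /eqP ->.
Qed.

End fourier_reconstruction.

(** * The fractional transform on the torus *)

Section complex_modulus.
Variable R : realType.
Implicit Types z w : R[i].

Lemma normc_le_ell1 z : Normc.normc z <= ell1 z.
Proof.
case: z => a b; rewrite /ell1 /= -[leRHS]ger0_norm; last exact: addr_ge0.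
rewrite -sqrtr_sqr ler_sqrt ?sqr_ge0// sqrrD !real_normK ?num_real//.
by rewrite lerD2r lerDl mulrn_wge0// mulr_ge0.
Qed.

Lemma ell1_le_normc z : ell1 z <= 2 * Normc.normc z.
Proof.
case: z => a b; rewrite /ell1 /= mulr2n mulrDl mul1r.
by apply: lerD; rewrite -sqrtr_sqr ler_sqrt ?addr_ge0 ?sqr_ge0// ?lerDl ?lerDr sqr_ge0.
Qed.

Lemma normcX z k : Normc.normc (z ^+ k) = Normc.normc z ^+ k.
Proof.
elim: k => [|k IHk]; first by rewrite !expr0 Normc.normc1.
by rewrite !exprS Normc.normcM IHk.
Qed.

Lemma normc_expi (t : R) : Normc.normc (expi t) = 1.
Proof. by rewrite /expi /= cos2Dsin2 sqrtr1. Qed.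

Lemma expiN_mul (t : R) : expi (- t) * expi t = 1.
Proof.
rewrite /expi cosN sinN; apply/eqP; rewrite eq_complex /=.
by rewrite mulNr opprK -!expr2 cos2Dsin2 mulNr [sin t * cos t]mulrC subrr !eqxx.
Qed.

Lemma frac_cst_neq0 (alpha : R) : frac_cst alpha != 0.
Proof. by rewrite /frac_cst sqrtc_eq0 eq_complex /= oner_eq0. Qed.

Lemma normc_gt0 z : z != 0 -> 0 < Normc.normc z.
Proof.
move=> z0; rewrite lt_neqAle; apply/andP; split.
  by rewrite eq_sym; apply: contra z0 => /eqP/Normc.eq0_normc ->.
by case: z {z0} => a b; exact: sqrtr_ge0.
Qed.

(** Otherwise the remainder of [alpha] modulo [pi] has zero sine; but the sine is
    positive strictly between [0] and [pi]. *)
Lemma sin_neq0 (alpha : R) : (forall k : int, alpha <> k%:~R * pi) -> sin alpha != 0.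
Proof.
move=> ha; apply/eqP => s0; pose k := Num.floor (alpha / pi).
have p0 := pi_gt0 R.
have /andP[k1 k2] : k%:~R <= alpha / pi < (k + 1)%:~R.
  by rewrite floor_le_tmp//= floorD1_gt.
apply: (ha k); apply/eqP; rewrite -subr_eq0 eq_le.
have y0 : 0 <= alpha - k%:~R * pi by rewrite subr_ge0 -ler_pdivlMr.
have y1 : alpha - k%:~R * pi < pi.
  have : alpha < (k + 1)%:~R * pi by rewrite -ltr_pdivrMr.
  by rewrite rmorphD mulrDl mul1r; lra.
rewrite y0 andbT leNgt; apply/negP => y2.
have : 0 < sin (alpha - k%:~R * pi) by apply: sin_gt0_pi; rewrite y2.
by rewrite sinB s0 sin_int_pi mul0r mulr0 subrr ltxx.
Qed.

End complex_modulus.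

Section torus_integral.
Variables (R : realType) (alpha : R) (n : nat).

Let mu := lebesgue_rV R n.
Let D := @torus_cube R alpha n.
Let mD : measurable D. Proof. exact: measurable_cube. Qed.

Lemma torus_int_mulc (K : R[i]) (h : 'rV[R]_n -> R[i]) :
  mu.-integrable D (fun x => (complex.Re (h x))%:E) ->
  mu.-integrable D (fun x => (complex.Im (h x))%:E) ->
  torus_int alpha (fun x => K * h x) = K * torus_int alpha h.
Proof.
case: K => a b ir ii; rewrite /torus_int.
have Z (c : R) w : mu.-integrable D (fun x => (w x)%:E) ->
    mu.-integrable D (EFin \o (fun x => c * w x)).
  by move=> iw; rewrite /comp; under eq_fun do rewrite EFinM; exact: integrableZl.
apply/eqP; rewrite eq_complex /=; apply/andP; split; apply/eqP.
  rewrite -!RintegralZl// -RintegralB//; try exact: Z.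
  by apply: eq_Rintegral => x _; case: (h x).
rewrite -!RintegralZl// -RintegralD//; try exact: Z.
by apply: eq_Rintegral => x _; case: (h x).
Qed.

Definition torus_char (g : 'rV[R]_n -> R[i]) (m : 'rV[int]_n) : R[i] :=
  torus_int alpha (fun x => g x * expi (- phase (2 * pi * csc alpha) m x)).

Lemma torus_charE g m :
  torus_char g m =
  (re_char (2 * pi * csc alpha) (`|sin alpha| / 2)
     (fun x => complex.Re (g x)) (fun x => complex.Im (g x)) m +i*
   re_char (2 * pi * csc alpha) (`|sin alpha| / 2)
     (fun x => complex.Im (g x)) (fun x => - complex.Re (g x)) m)%C.
Proof.
rewrite /torus_char /torus_int /re_char; congr (_ +i* _)%C;
  apply: eq_Rintegral => x _; rewrite /expi cosN sinN; case: (g x) => a b /=; ring.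
Qed.

(** The chirp of [f] cancels that of the kernel on the cube; what is left of the
    kernel is the usual character and a factor of modulus independent of [m]. *)
Lemma frac_fourier_chirp (f g : 'rV[R]_n -> R[i]) (m : 'rV[int]_n) :
  torus_L1 alpha g ->
  (forall x, torus_cube alpha x -> f x = chirp (- alpha) x * g x) ->
  frac_fourier alpha f m =
  (frac_cst alpha ^+ n * chirp alpha (int_rV R m)) * torus_char g m.
Proof.
move=> [_ ir ii] fg; rewrite /torus_char -torus_int_mulc.
- have E x : torus_cube alpha x -> f x * frac_kernel alpha (int_rV R m) x =
      frac_cst alpha ^+ n * chirp alpha (int_rV R m) *
      (g x * expi (- phase (2 * pi * csc alpha) m x)).
    move=> Dx; rewrite (fg x Dx) /frac_kernel chirpN.
    have -> : 2 * pi * dotr (int_rV R m) x * csc alpha =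
      phase (2 * pi * csc alpha) m x by rewrite /phase; ring.
    have h := expiN_mul (pi * enorm x ^+ 2 * cot alpha).
    rewrite /chirp in h *.
    transitivity (expi (- (pi * enorm x ^+ 2 * cot alpha)) *
      expi (pi * enorm x ^+ 2 * cot alpha) *
      (frac_cst alpha ^+ n * expi (pi * enorm (int_rV R m) ^+ 2 * cot alpha) *
        (g x * expi (- phase (2 * pi * csc alpha) m x)))); last by rewrite h mul1r.
    by ring.
  by rewrite /frac_fourier /torus_int; congr (_ +i* _)%C;
    apply: eq_Rintegral => x /set_mem Dx; rewrite E.
- have -> : (fun x => (complex.Re (g x * expi (- phase (2 * pi * csc alpha) m x)))%:E) =
    (fun x => ((complex.Re (g x) * cos (phase (2 * pi * csc alpha) m x))%:E +
               (complex.Im (g x) * sin (phase (2 * pi * csc alpha) m x))%:E)%E).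
    apply/funext => x; rewrite -EFinD /expi cosN sinN; case: (g x) => a b /=.
    by congr (_%:E); ring.
  apply: integrableD => //.
    exact: (integrable_mul_bounded ir (bounded_mfun_cos0 _ m)).
  exact: (integrable_mul_bounded ii (bounded_mfun_sin _ m)).
- have -> : (fun x => (complex.Im (g x * expi (- phase (2 * pi * csc alpha) m x)))%:E) =
    (fun x => ((complex.Im (g x) * cos (phase (2 * pi * csc alpha) m x))%:E -
               (complex.Re (g x) * sin (phase (2 * pi * csc alpha) m x))%:E)%E).
    apply/funext => x; rewrite -EFinB /expi cosN sinN; case: (g x) => a b /=.
    by congr (_%:E); ring.
  apply: integrableB => //.
    exact: (integrable_mul_bounded ii (bounded_mfun_cos0 _ m)).
  exact: (integrable_mul_bounded ir (bounded_mfun_sin _ m)).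
Qed.

End torus_integral.

(** * Multi-indices and the Hoelder seminorm *)

Section multi_index.
Variables (R : realType) (n : nat).

Lemma size_mi_word (beta : 'I_n -> nat) : size (mi_word beta) = mi_order beta.
Proof.
rewrite /mi_word size_flatten /shape -map_comp sumnE big_map big_enum /=.
by apply: eq_bigr => i _; rewrite size_nseq.
Qed.

Lemma has_mi_partial_cfseries (om p : R) (c : 'rV[int]_n -> R[i]) (beta : 'I_n -> nat) :
  (0 < n)%N -> (mi_order beta)%:R < p -> decays p c ->
  has_mi_partial beta (cfseries om c).
Proof.
move=> n0 bp dc w pw.
have sw : (size w)%:R < p by rewrite (perm_size pw) size_mi_word.
have sb : (size (mi_word beta))%:R < p by rewrite size_mi_word.
have [wd ->] := word_partial_cfseries om n0 sw dc; split=> //.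
have [_ e] := word_partial_cfseries om n0 sb dc.
by rewrite /mi_partial e (perm_wcoef om c pw).
Qed.

Lemma mi_partial_cfseries (om p : R) (c : 'rV[int]_n -> R[i]) (beta : 'I_n -> nat) :
  (0 < n)%N -> (mi_order beta)%:R < p -> decays p c ->
  mi_partial beta (cfseries om c) = cfseries om (wcoef om (mi_word beta) c).
Proof.
move=> n0 bp dc.
have sb : (size (mi_word beta))%:R < p by rewrite size_mi_word.
by have [] := word_partial_cfseries om n0 sb dc.
Qed.

Lemma dotLambda_cfseries (alpha om p gamma : R) (c : 'rV[int]_n -> R[i]) :
  (0 < n)%N -> `|om| * (`|sin alpha| / 2) = pi ->
  0 < gamma -> gamma <= 1 -> gamma < p -> decays p c ->
  dotLambda alpha gamma (cfseries om c).
Proof.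
move=> n0 omr g0 g1 gp dc; split.
  move=> x i; have -> : `|sin alpha| = (`|sin alpha| / 2) *+ 2.
    by rewrite mulr2n -splitr.
  by rewrite /cfseries !(fseries_periodic omr).
have [K1 h1] := fseries_hoelder om n0 g0 g1 gp dc.
have [K2 h2] := fseries_hoelder om n0 g0 g1 gp (decays_rotc dc).
apply: (@le_lt_trans _ _ (K1 + K2)%:E); last exact: ltry.
apply: ge_ereal_sup => _ [x [h [_ _ hn0 ->]]]; rewrite lee_fin.
have eh : 0 < enorm h.
  rewrite lt_neqAle sqrtr_ge0 andbT eq_sym; apply: contra hn0 => /eqP e0.
  apply/eqP/rowP => i; apply/eqP; rewrite mxE -normr_le0 -e0.
  exact: abs_coord_le_enorm.
rewrite ler_pdivrMr ?powR_gt0//; apply: le_trans (normc_le_ell1 _) _.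
by rewrite /ell1 /= mulrDl; apply: lerD; [exact: h1|exact: h2].
Qed.

End multi_index.

(** * The regularity theorem *)

Theorem proposition4p6 (R : realType) (n : nat) (hn : (1 <= n)%N)
  (alpha : R) (halpha : forall k : int, alpha <> k%:~R * pi)
  (s : R) (hs : 0 < s)
  (f : 'rV[R]_n -> R[i]) (hf : chirp_L1 alpha f)
  (C : R)
  (hC : forall m : 'rV[int]_n,
    Normc.normc (frac_fourier alpha f m) <=
      C * (1 + enorm (int_rV R m)) `^ (- s - n%:R)) :
  exists G : 'rV[R]_n -> R[i],
    [/\ torus_periodic alpha G,
        {ae lebesgue_rV R n,
          forall x, torus_cube alpha x -> G x = chirp alpha x * f x},
        forall beta : 'I_n -> nat,
          (mi_order beta)%:Z <= strict_floor s -> has_mi_partial beta G &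
        forall (beta : 'I_n -> nat) (gamma : R),
          (mi_order beta)%:Z = strict_floor s ->
          0 < gamma < s - (strict_floor s)%:~R ->
          dotLambda alpha gamma (mi_partial beta G)].
Proof.
have s0 := sin_neq0 halpha.
have [g gL1 fg] := hf.
pose om : R := 2 * pi * csc alpha; pose r : R := `|sin alpha| / 2.
have r0 : 0 < r by rewrite divr_gt0// normr_gt0.
have omr : `|om| * r = pi.
  rewrite /om /r /csc normrM normfV (ger0_norm (mulr_ge0 _ (pi_ge0 R)))//.
  by field; rewrite normr_eq0.
have LE : r *+ 2 = `|sin alpha| by rewrite mulr2n -splitr.
pose L : R := (r *+ 2) ^+ n.
have L0 : 0 < L by rewrite exprn_gt0// mulrn_wgt0.
(* [L] is the volume of the cube, so [c] are the Fourier coefficients of [g]. *)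
pose c (m : 'rV[int]_n) : R[i] :=
  ((L^-1 * complex.Re (torus_char alpha g m)) +i*
   (L^-1 * complex.Im (torus_char alpha g m)))%C.
have A0 := normc_gt0 (frac_cst_neq0 alpha).
pose a := Normc.normc (frac_cst alpha) ^+ n.
have a0 : 0 < a by rewrite exprn_gt0.
have dc : decays s c.
  exists (L^-1 * (2 * (a^-1 * C))) => m.
  have hTm : Normc.normc (torus_char alpha g m) <=
      a^-1 * C * lattice_weight R m `^ (- n%:R - s).
    rewrite -mulrA ler_pdivlMl//; have := hC m.
    rewrite (frac_fourier_chirp m gL1 fg) !Normc.normcM normcX normc_expi mulr1.
    by rewrite [- s - _]addrC.
  have -> : ell1 (c m) = L^-1 * ell1 (torus_char alpha g m).
    have ell1Z (z : R[i]) (k : R) :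
        ell1 ((k * complex.Re z) +i* (k * complex.Im z))%C = `|k| * ell1 z.
      by rewrite /ell1 /= !normrM mulrDr.
    by rewrite ell1Z gtr0_norm ?invr_gt0.
  rewrite -!mulrA ler_wpM2l ?invr_ge0 ?(ltW L0)//.
  apply: le_trans (ell1_le_normc _) _; rewrite ler_wpM2l//.
  by rewrite mulrA.
have sc := decays_summable hn hs dc.
have [k1 _] := strict_floorP s.
exists (cfseries om c); split.
- by move=> x i; rewrite -LE /cfseries !(fseries_periodic omr).
- have [_ ir ii] := gL1.
  have uv m : re_char om r (fun x => complex.Re (g x)) (fun x => complex.Im (g x)) m =
      L * complex.Re (c m).
    rewrite -[complex.Re (c m)]/(L^-1 * complex.Re (torus_char alpha g m)).
    by rewrite torus_charE mulVKf// gt_eqF.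
  have vu m : re_char om r (fun x => complex.Im (g x)) (fun x => - complex.Re (g x)) m =
      L * complex.Im (c m).
    rewrite -[complex.Im (c m)]/(L^-1 * complex.Im (torus_char alpha g m)).
    by rewrite torus_charE mulVKf// gt_eqF.
  have := ae_eq_fseries r0 omr sc ir ii uv vu.
  apply: filterS => x h Dx; have [e1 e2] := h Dx.
  rewrite (fg x Dx) mulrA [_ * chirp (- alpha) x]mulrC chirpN.
  by rewrite expiN_mul mul1r /cfseries -e1 -e2; case: (g x).
- move=> beta hb; apply: (has_mi_partial_cfseries om hn _ dc).
  by apply: le_lt_trans k1; rewrite -[leLHS]/((mi_order beta)%:Z%:~R) ler_int.
- move=> beta gamma hb /andP[g0 g1].
  have bk : (mi_order beta)%:R = (strict_floor s)%:~R :> R by rewrite -hb.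
  rewrite (mi_partial_cfseries om hn _ dc) ?bk//.
  have dw := decays_wcoef om (mi_word beta) dc.
  rewrite size_mi_word bk in dw.
  apply: (dotLambda_cfseries hn omr g0 _ g1 dw).
  apply: le_trans (ltW g1) _; rewrite lerBlDr /strict_floor.
  have := Num.Theory.ceil_ge s.
  by rewrite rmorphB /=; lra.
Qed.
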